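(* Let $\mathbf R\subset\mathbb R^2$ be a region of area $1$ and let $O$ be a point in the interior of $\mathbf R$. Take $O$ as the origin of polar coordinates and assume that the boundary $\partial\mathbf R$ is the curve $\{(r(\theta),\theta):\theta\in[0,2\pi]\}$, where $r$ is a positive, continuous, piecewise differentiable function. Let $A,B,C$ be independent points, each uniformly distributed in $\mathbf R$, and let $\mathcal P$ be the probability that the triangle $\triangle ABC$ contains $O$. Let $f$ be the density on $\partial\mathbf R$ (with respect to arc length) defined by the condition that $\int_{\overset{\frown}{st}} f(x)\,dx=\frac12\int_{\theta_s}^{\theta_t} r(\theta)^2\,d\theta$ for all boundary points $s=(r(\theta_s),\theta_s)$, $t=(r(\theta_t),\theta_t)$ with $\theta_s\le\theta_t$ and $\theta_t-\theta_s\le 2\pi$. Here $\overset{\frown}{st}$ is the arc of $\partial\mathbf R$ from $s$ to $t$, traversed counterclockwise. In particular $\int_{\partial\mathbf R}f=1$. Define the involution $F:\partial\mathbf R\to\partial\mathbf R$ by $F((r(\theta),\theta))=(r(\theta+\pi),\theta+\pi)$. For $t\in\partial\mathbf R$, let $H(t)=\int_{\overset{\frown}{tF(t)}}f(x)\,dx$; this is the area of the part of $\mathbf R$ lying to the right of the line from $t$ to $F(t)$. For a point $\mathbf u\in\partial\mathbf R$, put $\mathbf v=F(\mathbf u)$ and $G(t)=\int_{\overset{\frown}{\mathbf u t}}f(x)\,dx$. Then the following hold. (i) For every $\mathbf u\in\partial\mathbf R$, $$\mathcal P=-G(\mathbf v)^2\,[3-2G(\mathbf v)]+6\int_{\overset{\frown}{\mathbf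 u\mathbf v}}H(t)\,[1-H(t)]\,f(t)\,dt .$$ (ii) For every $\mathbf u\in\partial\mathbf R$, with $x=G(\mathbf v)$, $$\mathcal P=\frac14-\frac{(1-2x)^3}{4}-6\int_{\overset{\frown}{\mathbf u\mathbf v}}\Big[\frac12-H(t)\Big]^2 f(t)\,dt .$$ (iii) There exists $\mathbf u\in\partial\mathbf R$ such that $$\mathcal P=\frac14-6\int_{\overset{\frown}{\mathbf u\mathbf v}}\Big[\frac12-H(t)\Big]^2 f(t)\,dt .$$ (iv) Independently of any choice of $\mathbf u$, $$\mathcal P=-\frac12+3\int_{\partial\mathbf R}H(t)\,[1-H(t)]\,f(t)\,dt=\frac14-3\int_{\partial\mathbf R}\Big[\frac12-H(t)\Big]^2 f(t)\,dt .$$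
   Context: All integrals of the form $\int \varphi(t)f(t)\,dt$ over an arc of $\partial\mathbf R$ are taken with respect to the measure $f(t)\,dt$. Equivalently, in the polar parametrization this measure is $\frac12 r(\theta)^2\,d\theta$. Arcs of $\partial\mathbf R$ are always traversed counterclockwise. *)

(* Defs.v *)
From HB Require Import structures.
From mathcomp Require Import all_boot all_order all_algebra.
From mathcomp Require Import all_classical all_reals all_analysis.
Set Implicit Arguments. Unset Strict Implicit. Unset Printing Implicit Defensive.
Import Order.TTheory GRing.Theory Num.Theory.
Import numFieldNormedType.Exports.
Local Open Scope classical_set_scope.
Local Open Scope ring_scope.

Section Defs.
Variable R : realType.

Definition area :=
  (@lebesgue_measure R \x @lebesgue_measure R)%E.

Definition area3 := (area \x area \x area)%E.

Definition polar_region (O : R * R) (r : R -> R) : set (R * R) :=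
  [set p | exists rho th, 0 <= rho <= r th /\
     p = (O.1 + rho * cos th, O.2 + rho * sin th)].

Definition in_triangle (o a b c : R * R) : Prop :=
  exists al be ga : R, 0 <= al /\ 0 <= be /\ 0 <= ga /\ al + be + ga = 1 /\
     o.1 = al * a.1 + be * b.1 + ga * c.1 /\
     o.2 = al * a.2 + be * b.2 + ga * c.2.

(* Probability that the triangle of three independent uniform points of a
   region Reg of area 1 contains o. *)
Definition triangle_prob (o : R * R) (Reg : set (R * R)) : \bar R :=
  area3 [set x | Reg x.1.1 /\ Reg x.1.2 /\ Reg x.2 /\
                 in_triangle o x.1.1 x.1.2 x.2].

Definition piecewise_derivable (r : R -> R) : Prop :=
  exists s : seq R, forall th, 0 <= th <= 2 * pi -> th \notin s ->
    derivable r th 1.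

(* Boundary points are parametrised by their polar angle theta.
   Integral over the ccw arc from angle a to angle b (a <= b) of
   phi(t) f(t) dt, where f(t) dt = (1/2) r(theta)^2 dtheta. *)
Definition arc_int (r phi : R -> R) (a b : R) : R :=
  Rintegral lebesgue_measure `[a, b] (fun th => phi th * (r th ^+ 2 / 2)).

Definition Hfun (r : R -> R) (th : R) : R := arc_int r (fun _ => 1) th (th + pi).

Definition Gfun (r : R -> R) (thu tht : R) : R := arc_int r (fun _ => 1) thu tht.

End Defs.

(* Main.v *)
(* Write [f = r^2 / 2]. In the slope coordinates [(x, s) |-> O + (x, x s)] the
   Lebesgue measure is [|x| dx ds], and integrating out [x] and substituting
   [s = tan t] shows that the polar angle of a uniform point of the region has
   density [f]. Hence the part of the region to the left of the ray from [O]
   through a point of angle [t] has area [H t], the integral of [f] over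
   [[t, t + pi]].

   For almost all triples of points, either [O] lies in the triangle, or exactly
   one vertex sees the other two on its left. The latter event has probability
   [3 int H^2 f], so that [P = 1 - 3 int H^2 f] over a full turn.

   The rest is calculus: [H' t = f (t + pi) - f t] and [H (t + pi) = 1 - H t]
   fold the integral over a full turn into one over a half turn, and the
   intermediate value theorem gives a half turn with [H = 1/2]. *)

Require Import Defs.
From HB Require Import structures.
From mathcomp Require Import all_boot all_order all_algebra.
From mathcomp Require Import all_classical all_reals all_analysis.
From mathcomp Require Import measurable_realfun ring lra.
Import Order.TTheory GRing.Theory Num.Theory.
Import numFieldNormedType.Exports.
Set Implicit Arguments. Unset Strict Implicit. Unset Printing Implicit Defensive.
Local Open Scope classical_set_scope.
Local Open Scope ring_scope.

(** * Primitives and half turns *)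

(** The slope chart stands in for polar coordinates because its change of variables consists of
    one-dimensional affine substitutions and Tonelli. A slope names a whole line: [x > 0] gives the
    angle [atan s] and [x < 0] the angle [atan s + pi], so one pass over the slopes sweeps the turn
    from [- (pi / 2)] to [3 * pi / 2], and the missing vertical line is null. The side test also
    becomes elementary, since the cross product of two points is [x * x' * (s' - s)]. Integrals
    against [f] are handled through primitives on the whole line, so that each identity reduces to a
    function with zero derivative. When the full turn is folded, [f (t + pi)] is replaced by
    [f t + H' t]; the part with [H'] integrates [(1 - H)^2] exactly and produces the cubic boundary
    terms of (i) and (ii). *)

Section antiderivative.
Context {R : realType}.
Notation mu := (@lebesgue_measure R).
Implicit Types (f F : R -> R) (a b c x : R).

Lemma continuous_segment_integrable f a b : continuous f ->
  mu.-integrable `[a, b] (EFin \o f).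
Proof.
move=> cf; apply: continuous_compact_integrable; first exact: segment_compact.
exact: continuous_subspaceT.
Qed.

Lemma Rintegral_segment_split f a b c : continuous f -> a <= b -> b <= c ->
  \int[mu]_(t in `[a, c]) f t =
  \int[mu]_(t in `[a, b]) f t + \int[mu]_(t in `[b, c]) f t.
Proof.
move=> cf ab bc; rewrite -[X in _ = _ + X]Rintegral_itv_obnd_cbnd; last first.
  apply: integrableS (continuous_segment_integrable b c cf) => //.
  by apply: subset_itvr; rewrite bnd_simp.
rewrite -(@Rintegral_itvB _ f (BLeft a) (BRight c) b) ?bnd_simp//.
  by rewrite addrC subrK.
exact: continuous_segment_integrable.
Qed.

(* The base point of the integral moves with [x], so that the primitive is
   defined on the whole line, negative half included. *)
Lemma continuous_antiderivative f : continuous f ->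
  exists F, forall x, is_derive x 1 F (f x).
Proof.
move=> cf; pose J a x := \int[mu]_(t in `[a, x]) f t.
exists (fun x => J (- `|x| - 1) x - J (- `|x| - 1) 0) => x.
(* Near [x] one has [|y| < |x| + 1], so this fixed base lies below every moving base [- |y| - 1].
   Changing the base only adds a constant, which the subtracted value at [0] cancels. *)
pose a := - `|x| - 2.
have ax : a < x by rewrite /a; have := ler_norm (- x); rewrite normrN; lra.
have base b y : a <= b -> b <= y -> b <= 0 -> J b y - J b 0 = J a y - J a 0.
  move=> ab yb b0.
  rewrite /J (Rintegral_segment_split cf ab yb).
  by rewrite (Rintegral_segment_split cf ab b0); lra.
have [dJ J'] : derivable (J a) x 1 /\ ((J a)^`())%classic x = f x.
  apply: (@continuous_FTC1_closed _ _ _ _ (x + 1)) => //.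
  - by rewrite ltrDl.
  - exact: continuous_segment_integrable.
  - exact: cf.
apply: (@near_eq_is_derive _ _ _ (fun y => J a y - J a 0)).
  near=> y; apply/esym/base.
  - have : `|x - y| < 1 by near: y; exact: (nbhsx_ballx x 1 ltr01).
    have := lerB_dist y x; rewrite distrC /a => *; lra.
  - by have := ler_norm (- y); rewrite normrN; lra.
  - by have := normr_ge0 y; lra.
rewrite -[f x]subr0; apply: is_deriveB.
by split => //; rewrite -derive1E.
Unshelve. all: by end_near. Qed.

Lemma is_derive_comp_shift F c x d : is_derive (x + c) 1 F d ->
  is_derive x 1 (fun t => F (t + c)) d.
Proof.
move=> dF; rewrite -[d]mulr1.
exact: (@is_derive1_comp _ F (shift c) x d 1 dF (is_derive_shift _ _ _)).
Qed.

Lemma is_derive_continuous F f : (forall x, is_derive x 1 F (f x)) ->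
  continuous F.
Proof.
by move=> dF x; apply: differentiable_continuous; apply/derivable1_diffP.
Qed.

Lemma Rintegral_antiderivative f F a b : continuous f ->
  (forall x, is_derive x 1 F (f x)) -> a < b ->
  \int[mu]_(t in `[a, b]) f t = F b - F a.
Proof.
move=> cf dF ab; have cF := is_derive_continuous dF.
rewrite /Rintegral (@continuous_FTC2 _ _ F)//.
- exact: continuous_subspaceT.
- split=> //; [exact: cvg_at_right_filter (cF _)|exact: cvg_at_left_filter (cF _)].
- by move=> x _; rewrite derive1E (@derive_val _ _ _ _ _ _ _ (dF x)).
Qed.

End antiderivative.

Definition half_turn {R : realType} (K : R -> R) (x : R) := K (x + pi) - K x.

Section half_turn_identities.
Context {R : realType}.
Variables (f K L M N : R -> R).
Hypothesis dK : forall x : R, is_derive x 1 K (f x).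
Hypothesis K_period : forall x, K (x + 2 * pi) = K x + 1.
Hypothesis f_period : forall x, f (x + 2 * pi) = f x.
Let H := half_turn K.
Hypothesis dL : forall x : R, is_derive x 1 L ((1 / 2 - H x) ^+ 2 * f x).
Hypothesis dM : forall x : R, is_derive x 1 M (H x ^+ 2 * f x).
Hypothesis dN : forall x : R, is_derive x 1 N (H x * (1 - H x) * f x).

Lemma half_turn_opposite x : H (x + pi) = 1 - H x.
Proof.
rewrite /H /half_turn; have -> : x + pi + pi = x + 2 * pi by ring.
by rewrite K_period; ring.
Qed.

Lemma is_derive_half_turn (x : R) : is_derive x 1 H (f (x + pi) - f x).
Proof. by apply: is_deriveB; apply: is_derive_comp_shift. Qed.

Lemma square_primitive_half_turn x :
  M (x + 2 * pi) - M x = 2 * (L (x + pi) - L x) + H x / 2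
                         + ((1 - H x) ^+ 3 - H x ^+ 3) / 3.
Proof.
(* [T] is constant because [H^2 + (1 - H)^2 = 2 (1/2 - H)^2 + 1/2]. *)
pose T t := M t + M (t + pi) - 2 * L t - K t / 2 + (1 - H t) ^+ 3 / 3.
have dT (t : R) : is_derive t 1 T 0.
  have dMp := is_derive_comp_shift (dM (t + pi)).
  have dH := is_derive_half_turn t.
  rewrite /T.
  have -> : (fun t => M t + M (t + pi) - 2 * L t - K t / 2 + (1 - H t) ^+ 3 / 3)
     = ((M + (fun t => M (t + pi))) - 2 \*: L - (1 / 2) \*: K)
       + (1 / 3) \*: ((cst 1 - H) ^+ 3).
    by apply/funext => u; rewrite !fctE /= /GRing.scale/= ; field.
  apply: is_derive_eq; rewrite /GRing.scale/= half_turn_opposite !fctE/=.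
  by rewrite /GRing.scale/=; field.
have := @is_derive_0_is_cst _ T (x + pi) x dT.
rewrite /T half_turn_opposite.
have -> : x + pi + pi = x + 2 * pi by ring.
by rewrite /H /half_turn => E; lra.
Qed.

(** Lets the starting angle move: the slopes yield the turn that starts at [- (pi / 2)], whereas (i)
    and (ii) start at an arbitrary angle. The increment over a turn has derivative zero because [H]
    and [f] are periodic. *)
Lemma square_primitive_period x y :
  M (x + 2 * pi) - M x = M (y + 2 * pi) - M y.
Proof.
apply: (is_derive_0_is_cst (f := fun x => M (x + 2 * pi) - M x)) => t.
have H_period : H (t + 2 * pi) = H t.
  rewrite (_ : t + 2 * pi = t + pi + pi); last by ring.
  by rewrite !half_turn_opposite; ring.
rewrite -(subrr (H t ^+ 2 * f t)); apply: is_deriveB.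
by apply: is_derive_comp_shift; have := dM (t + 2 * pi); rewrite H_period f_period.
Qed.

(** Integrated form of [H * (1 - H) = 1 / 4 - (1 / 2 - H)^2]. *)
Lemma product_primitive x y :
  N y - N x = (K y - K x) / 4 - (L y - L x).
Proof.
pose T t := N t + L t - K t / 4.
have dT (t : R) : is_derive t 1 T 0.
  have -> : T = (N + L - (1 / 4) \*: K) by
    apply/funext => u; rewrite /T !fctE/= /GRing.scale/=; field.
  by apply: is_derive_eq; rewrite /GRing.scale/=; field.
by have := @is_derive_0_is_cst _ T y x dT; rewrite /T; lra.
Qed.

Lemma half_turn_bisection : exists x, H x = 1 / 2.
Proof.
have cH : continuous H by apply: is_derive_continuous is_derive_half_turn.
have [||x _ ?] := @IVT _ H 0 pi (1 / 2) (pi_ge0 R); last by exists x.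
  exact: continuous_subspaceT.
(* As [H pi = 1 - H 0], the value [1 / 2] lies between those at the two ends. *)
have := half_turn_opposite 0; rewrite add0r => ->.
by rewrite minEle maxEle; case: ifP => h; apply/andP; split; lra.
Qed.

End half_turn_identities.

(** * Slope coordinates and triple products *)

Section change_of_variables.
Context {R : realType}.
Notation mu := (@lebesgue_measure R).
Local Open Scope ereal_scope.

(** The pushforward of Lebesgue measure under [s |-> a * s + b], scaled by [|a|], gives half-open
    intervals their length, which determines the measure. Negative [a] is included because the slope
    chart uses [y = O.2 + x * s] for [x < 0] as well. *)
Lemma ge0_integral_affine (a b : R) (f : R -> \bar R) : a != 0%R ->
  measurable_fun [set: R] f -> (forall y, 0 <= f y) ->
  \int[mu]_y f y = `|a|%:E * \int[mu]_s f (a * s + b)%R.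
Proof.
move=> a0 mf f0.
pose phi : measurableTypeR R -> measurableTypeR R := fun s => (a * s + b)%R.
have mphi : measurable_fun setT phi.
  by apply: measurable_funD => //; exact: measurable_funM.
have aN0 : (0 <= `|a|)%R by [].
have fphi : \int[mu]_s f (a * s + b)%R = \int[pushforward mu phi]_y f y.
  by rewrite (ge0_integral_pushforward mphi)//.
rewrite {}fphi -(ge0_integral_mscale _ measurableT (NngNum aN0))//.
apply: eq_measure_integral => A mA _; apply: lebesgue_measure_unique => //.
  move=> _ [[c d] _ <-] /=.
  rewrite /mscale /= /pushforward.
  have [{}a0|{}a0|az] := ltrgt0P a; last by rewrite az eqxx in a0.
  - rewrite (_ : phi @^-1` _ = `]((c - b) / a)%R, ((d - b) / a)%R]%classic); last first.
      apply/seteqP; split => s /=; rewrite !in_itv/= /phi ltr_pdivrMr// ler_pdivlMr//;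
        by rewrite ltrBlDr lerBrDr mulrC.
    rewrite !lebesgue_measure_itv/= !lte_fin ltr_pM2r ?invr_gt0// ltrD2r.
    case: ifP => _; last by rewrite mule0.
    by rewrite -EFinB -EFinM; congr EFin; field; rewrite gt_eqF.
  - rewrite (_ : phi @^-1` _ = `[((d - b) / a)%R, ((c - b) / a)%R[%classic); last first.
      apply/seteqP; split => s /=; rewrite !in_itv/= /phi ltr_ndivlMr// ler_ndivrMr//;
        by rewrite ltrBlDr lerBrDr mulrC andbC.
    rewrite !lebesgue_measure_itv/= !lte_fin ltr_nM2r ?invr_lt0// ltrD2r.
    case: ifP => _; last by rewrite mule0.
    by rewrite -EFinB -EFinM; congr EFin; field; rewrite lt_eqF.
Qed.

(** For each [x <> 0] the ordinate is substituted by [O.2 + x * s], which contributes the factor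
    [|x|]; Tonelli then exchanges [x] and [s]. *)
Lemma ge0_integral_slope (O : R * R) (f : R * R -> \bar R) :
  measurable_fun [set: R * R] f -> (forall p, 0 <= f p) ->
  \int[mu \x mu]_p f p =
  \int[mu]_s \int[mu]_x (`|x|%:E * f (O.1 + x, O.2 + x * s)%R).
Proof.
move=> mf f0.
have mf_shear : measurable_fun [set: R * R]
    (fun p : R * R => f (O.1 + p.1, O.2 + p.1 * p.2)%R).
  apply: measurableT_comp => //; apply: measurable_fun_pair.
    exact: measurable_funD.
  by apply: measurable_funD => //; exact: measurable_funM.
pose g (p : R * R) := `|p.1|%:E * f (O.1 + p.1, O.2 + p.1 * p.2)%R.
have mg : measurable_fun [set: R * R] g.
  apply: emeasurable_funM => //; apply/measurable_EFinP.
  by apply: measurableT_comp => //; exact: normr_measurable.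
have g0 p : 0 <= g p by rewrite mule_ge0.
rewrite fubini_tonelli1//; have mF := measurable_fun_fubini_tonelli_F (m2 := mu) _ mf f0.
rewrite (@ge0_integral_affine 1 O.1 _ (oner_neq0 _) mF); last first.
  by move=> x; exact: integral_ge0.
rewrite normr1 mul1e.
transitivity (\int[mu]_x \int[mu]_s g (x, s)); last by rewrite fubini_tonelli.
have mFx : measurable_fun [set: R] (fun x : R => fubini_F mu f (1 * x + O.1)%R).
  apply: measurableT_comp => //.
  by apply: measurable_funD => //; exact: measurable_funM.
have mG := measurable_fun_fubini_tonelli_F (m2 := mu) _ mg g0.
(* At [x = 0] the substitution degenerates, so this single abscissa is removed on both sides. *)
rewrite -[LHS](@integral_setD1 _ _ 0%R)//; last 2 first.
- exact: measurableD.
- exact: measurable_funS mFx.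
rewrite -[RHS](@integral_setD1 _ _ 0%R)//; last 2 first.
- exact: measurableD.
- exact: measurable_funS mG.
apply: eq_integral => x; rewrite inE => -[_ /= /eqP x0].
rewrite mul1r addrC /fubini_F /g /= ge0_integralZl//=.
- rewrite [LHS](@ge0_integral_affine x O.2)//; last first.
    by apply: measurable_fun_pair2 mf.
  by congr (_ * _); apply: eq_integral => s _; rewrite (addrC (x * s)%R).
- exact: (measurable_fun_pair2 x mf_shear).
Qed.

End change_of_variables.

(** * Tonelli for three independent points *)

Section product_sigma_finite_measure.
Context d1 d2 (T1 : measurableType d1) (T2 : measurableType d2) (R : realType).
Variable m1 : {sigma_finite_measure set T1 -> \bar R}.
Variable m2 : {sigma_finite_measure set T2 -> \bar R}.
Local Open Scope ereal_scope.

Lemma sigma_finite_product_measure : sigma_finite setT (m1 \x m2).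
Proof.
have /sigma_finiteP[F [F_cover F_nd F_fin]] := sigma_finiteT m1.
have /sigma_finiteP[G [G_cover G_nd G_fin]] := sigma_finiteT m2.
exists (fun n => F n `*` G n) => [|n]; last first.
  have [mF Fn] := F_fin n; have [mG Gn] := G_fin n; split; first exact: measurableX.
  by rewrite product_measure1E// lte_mul_pinfty// ge0_fin_numE.
apply/seteqP; split=> // -[x y] _.
have [i _ Fx] : (\bigcup_n F n) x by rewrite -F_cover.
have [j _ Gy] : (\bigcup_n G n) y by rewrite -G_cover.
exists (maxn i j) => //; split.
- by move/subsetPset: (F_nd _ _ (leq_maxl i j)); exact.
- by move/subsetPset: (G_nd _ _ (leq_maxr i j)); exact.
Qed.

(* The canonical sigma-finite structure on [m1 \x m2] found by unification
   only covers subprobabilities. *)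
Definition product_sigma_finite_measure :
    {sigma_finite_measure set (T1 * T2)%type -> \bar R} :=
  HB.pack (m1 \x m2) (Measure_isSigmaFinite.Build _ _ _ (m1 \x m2)
    sigma_finite_product_measure).

End product_sigma_finite_measure.

Section triple_products.
Context d (T : measurableType d) (R : realType).
Variable m : {sigma_finite_measure set T -> \bar R}.
Variables (w : T -> \bar R) (u v : T * T -> \bar R).
Hypotheses (mw : measurable_fun setT w) (w0 : forall a, (0 <= w a)%E).
Hypotheses (mfu : measurable_fun setT u) (u0 : forall p, (0 <= u p)%E).
Hypotheses (mfv : measurable_fun setT v) (v0 : forall p, (0 <= v p)%E).
Local Open Scope ereal_scope.

Lemma triple_product_indic (A : set (T * T * T)) : measurable A ->
  (m \x m \x m) A = \int[m \x m \x m]_x (\1_A x : R)%:E.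
Proof. by move=> mA; rewrite integral_indic// setIT. Qed.

Let U := fubini_F m u.
Let V := fubini_F m v.
Let mU : measurable_fun setT U.
Proof. exact: measurable_fun_fubini_tonelli_F. Qed.
Let mV : measurable_fun setT V.
Proof. exact: measurable_fun_fubini_tonelli_F. Qed.
Let U0 a : 0 <= U a. Proof. exact: integral_ge0. Qed.
Let V0 a : 0 <= V a. Proof. exact: integral_ge0. Qed.
Let mua a : measurable_fun setT (fun b => u (a, b)).
Proof. exact: measurable_fun_pair2. Qed.
Let mva a : measurable_fun setT (fun b => v (a, b)).
Proof. exact: measurable_fun_pair2. Qed.

(** Given the vertex [a], the other two points are independent, so their factors integrate
    separately to [U a] and [V a]. The nested product measure is not symmetric in form, so each
    position of the vertex needs its own order of integration. *)
Lemma triple_product1 :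
  \int[m \x m \x m]_x (w x.1.1 * u (x.1.1, x.1.2) * v (x.1.1, x.2)) =
  \int[m]_a (w a * U a * V a).
Proof.
rewrite (fubini_tonelli1 (m1 := product_sigma_finite_measure m m) (m2 := m)); first last.
- by move=> x; rewrite !mule_ge0.
- apply: emeasurable_funM; [apply: emeasurable_funM|].
  + by apply: measurableT_comp => //; exact: measurableT_comp.
  + apply: measurableT_comp => //.
    by apply: measurable_fun_pair; exact: measurableT_comp.
  + apply: measurableT_comp => //; apply: measurable_fun_pair => //.
    exact: measurableT_comp.
rewrite /fubini_F /=.
under eq_integral => p _ do rewrite ge0_integralZl// ?mule_ge0//.
rewrite (fubini_tonelli1 (m1 := m) (m2 := m)); first last.
- by move=> p; rewrite !mule_ge0// V0.
- apply: emeasurable_funM; [apply: emeasurable_funM|].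
  + exact: measurableT_comp.
  + by apply: measurableT_comp => //; exact: measurable_fun_pair.
  + exact: (measurableT_comp mV).
apply: eq_integral => a _; rewrite /fubini_F /=.
under eq_integral => b _ do rewrite muleAC.
by rewrite ge0_integralZl// ?mule_ge0// ?V0// muleAC.
Qed.

Lemma triple_product2 :
  \int[m \x m \x m]_x (w x.1.2 * u (x.1.2, x.1.1) * v (x.1.2, x.2)) =
  \int[m]_a (w a * U a * V a).
Proof.
rewrite (fubini_tonelli1 (m1 := product_sigma_finite_measure m m) (m2 := m)); first last.
- by move=> x; rewrite !mule_ge0.
- apply: emeasurable_funM; [apply: emeasurable_funM|].
  + by apply: measurableT_comp => //; exact: measurableT_comp.
  + apply: measurableT_comp => //.
    by apply: measurable_fun_pair; exact: measurableT_comp.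
  + apply: measurableT_comp => //; apply: measurable_fun_pair => //.
    exact: measurableT_comp.
rewrite /fubini_F /=.
under eq_integral => p _ do rewrite ge0_integralZl// ?mule_ge0//.
rewrite (fubini_tonelli2 (m1 := m) (m2 := m)); first last.
- by move=> p; rewrite !mule_ge0// V0.
- apply: emeasurable_funM; [apply: emeasurable_funM|].
  + exact: measurableT_comp.
  + by apply: measurableT_comp => //; exact: measurable_fun_pair.
  + exact: (measurableT_comp mV).
apply: eq_integral => a _; rewrite /fubini_G /=.
under eq_integral => b _ do rewrite muleAC.
by rewrite ge0_integralZl// ?mule_ge0// ?V0// muleAC.
Qed.

Lemma triple_product3 :
  \int[m \x m \x m]_x (w x.2 * u (x.2, x.1.1) * v (x.2, x.1.2)) =
  \int[m]_a (w a * U a * V a).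
Proof.
rewrite (fubini_tonelli2 (m1 := product_sigma_finite_measure m m) (m2 := m)); first last.
- by move=> x; rewrite !mule_ge0.
- apply: emeasurable_funM; [apply: emeasurable_funM|].
  + exact: measurableT_comp.
  + apply: measurableT_comp => //; apply: measurable_fun_pair => //.
    exact: measurableT_comp.
  + apply: measurableT_comp => //; apply: measurable_fun_pair => //.
    exact: measurableT_comp.
apply: eq_integral => a _; rewrite /fubini_G /=.
rewrite (fubini_tonelli1 (m1 := m) (m2 := m)); first last.
- by move=> p; rewrite !mule_ge0.
- apply: emeasurable_funM; [apply: emeasurable_funM|] => //.
  + exact: (measurableT_comp (mua a)).
  + exact: (measurableT_comp (mva a)).
rewrite /fubini_F /=.
under eq_integral => b _ do rewrite ge0_integralZl// ?mule_ge0//.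
under eq_integral => b _ do rewrite muleAC.
by rewrite ge0_integralZl// ?mule_ge0// ?V0// muleAC.
Qed.

End triple_products.

(** * Geometry of the polar region *)

Section polar_region_membership.
Context {R : realType}.
Implicit Types (O p : R * R) (r : R -> R) (x y s t : R).

(** Membership in the region only provides some angle of a point; this makes the radius bound
    independent of the angle chosen. The difference of two such angles has cosine [1], hence is a
    multiple of [2 * pi]. *)
Lemma periodic_cos_sin_inj r t t' : (forall th, r (th + 2 * pi) = r th) ->
  cos t = cos t' -> sin t = sin t' -> r t = r t'.
Proof.
move=> rper ct st; pose d := t - t'.
have cd : cos d = 1 by rewrite /d cosB ct st -!expr2 cos2Dsin2.
have perz (g : R -> R) : (forall th, g (th + 2 * pi) = g th) ->
    forall (k : int) th, g (th + k%:~R * (2 * pi)) = g th.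
  move=> gper; have pern n th : g (th + n%:R * (2 * pi)) = g th.
    elim: n th => [|n IH] th; first by rewrite mul0r addr0.
    by rewrite -natr1 mulrDl mul1r addrA gper IH.
  case=> n th; first by rewrite -pmulrn pern.
  rewrite NegzE mulrNz mulNr -pmulrn.
  by rewrite -[in RHS](subrK (n.+1%:R * (2 * pi)) th) pern.
(* [e] is the difference of the angles reduced to [[0, 2 * pi)]. *)
pose n := Num.floor (d / (2 * pi)); pose e := d - n%:~R * (2 * pi).
have pi2 : 0 < 2 * pi :> R by rewrite mulr_gt0 ?pi_gt0.
have /andP[e0 e2] : 0 <= e < 2 * pi.
  have /andP[] := floor_itv (d / (2 * pi)); rewrite -/n.
  rewrite ler_pdivlMr// ltr_pdivrMr// intrD (mulrDl n%:~R) (mul1r (2 * pi)) => h1 h2.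
  by rewrite /e subr_ge0 h1 ltrBlDl h2.
have ce : cos e = 1.
  rewrite -cd /e -mulNr -mulrNz perz// => th.
  by rewrite mulrC mulr_natr cosD2pi.
have e_eq0 : e = 0.
  (* [cos] is injective only on [[0, pi]]; beyond [pi] the reflected angle [2 * pi - e] is used, and
     its vanishing contradicts [e < 2 * pi]. *)
  have [epi|pie] := leP e pi.
    by apply: (@cos_inj R); rewrite ?in_itv/= ?lexx ?pi_ge0 ?e0 ?epi// ce cos0.
  have : 2 * pi - e = 0.
    apply: (@cos_inj R); rewrite ?in_itv/= ?lexx ?pi_ge0//.
      by apply/andP; split; lra.
    by rewrite cos0 -cosN opprB -cosD2pi -(mulr_natl pi) subrK.
  by move=> h; lra.
rewrite -[in RHS](perz r rper n t'); congr r.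
by move: e_eq0; rewrite /e /d; lra.
Qed.

Variables (O : R * R) (r : R -> R).
Hypotheses (r_pos : forall th, 0 < r th)
  (r_per : forall th, r (th + 2 * pi) = r th).

Lemma polar_region_polar rho t : 0 < rho ->
  polar_region O r (O.1 + rho * cos t, O.2 + rho * sin t) <-> rho <= r t.
Proof.
move=> rho0; split=> [[rho' [th [/andP[rho'0 rho'r] [/addrI E1 /addrI E2]]]]|le_r].
  have E : rho = rho'.
    apply/eqP; rewrite -(eqrXn2 (_ : 0 < 2)%N)// ?ltW//; apply/eqP.
    rewrite -[LHS]mulr1 -[RHS]mulr1 -{1}(cos2Dsin2 t) -(cos2Dsin2 th).
    by rewrite !mulrDr -!exprMn E1 E2.
  move: E1 E2; rewrite -E => /(mulfI (lt0r_neq0 rho0)) E1.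
  move=> /(mulfI (lt0r_neq0 rho0)) E2.
  by rewrite (periodic_cos_sin_inj r_per E1 E2) E.
by exists rho, t; split=> //; rewrite (ltW rho0).
Qed.

Lemma cos_atan_gt0 s : 0 < cos (atan s).
Proof. by apply: cos_gt0_pihalf; rewrite atan_gtNpi2 atan_ltpi2. Qed.

Lemma sin_atanE s : sin (atan s) = s * cos (atan s).
Proof. by rewrite -[X in _ = X * _]atanK /tan divfK// gt_eqF// cos_atan_gt0. Qed.

(** On the ray of angle [atan s], the abscissa [x] corresponds to the radius [x / cos (atan s)]. *)
Lemma polar_region_right x s : 0 < x ->
  polar_region O r (O.1 + x, O.2 + x * s) <-> x <= r (atan s) * cos (atan s).
Proof.
move=> x0; have c0 := cos_atan_gt0 s.
rewrite -ler_pdivrMr// -polar_region_polar ?divr_gt0// sin_atanE.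
by rewrite mulrCA divfK ?gt_eqF// (mulrC s).
Qed.

Lemma polar_region_left x s : x < 0 ->
  polar_region O r (O.1 + x, O.2 + x * s) <->
  - x <= r (atan s + pi) * cos (atan s).
Proof.
move=> x0; have c0 := cos_atan_gt0 s.
rewrite -ler_pdivrMr// -polar_region_polar ?divr_gt0 ?oppr_gt0//.
rewrite cosDpi sinDpi sin_atanE !mulrN !mulNr !opprK.
by rewrite mulrCA divfK ?gt_eqF// (mulrC s).
Qed.

(** Slopes miss the vertical line. It is negligible for integrals, but measurability of the region
    concerns every point. *)
Lemma polar_region_vertical y :
  polar_region O r (O.1, O.2 + y) <-> - r (- (pi / 2)) <= y <= r (pi / 2).
Proof.
have [y0|y0|->] := ltrgt0P y.
- have := polar_region_polar (pi / 2) y0.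
  rewrite cos_pihalf sin_pihalf mulr0 addr0 mulr1 => ->.
  suff -> : - r (- (pi / 2)) <= y by [].
  by have := r_pos (- (pi / 2)); lra.
- have Ny0 : 0 < - y by rewrite oppr_gt0.
  have := polar_region_polar (- (pi / 2)) Ny0.
  rewrite cosN sinN cos_pihalf sin_pihalf mulr0 addr0 mulrN1 opprK => ->.
  rewrite lerNl; suff -> : y <= r (pi / 2) by rewrite andbT.
  by have := r_pos (pi / 2); lra.
- rewrite oppr_le0 !ltW// addr0; split=> // _.
  by exists 0, 0; rewrite lexx ltW// !mul0r !addr0; split=> //; case: O.
Qed.

End polar_region_membership.

Section polar_region_measurable.
Context {R : realType}.
Variables (O : R * R) (r : R -> R).
Hypotheses (r_pos : forall th, 0 < r th) (r_cont : continuous r)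
  (r_per : forall th, r (th + 2 * pi) = r th).

Lemma measurable_pred d (T : measurableType d) (b : T -> bool) :
  measurable_fun setT b -> measurable [set x | b x].
Proof. by move=> mb; rewrite -[X in measurable X]setTI; exact: (mb _ [set true]). Qed.

Lemma measurable_inv : measurable_fun [set: R] (@GRing.inv R).
Proof.
(* Inversion is discontinuous at [0], so it is expressed by the measurable power function; at [0]
   the factor [x] reproduces the default value [0^-1 = 0]. *)
apply: (eq_measurable_fun (fun x : R => x * (x ^+ 2) `^ (-1))).
  move=> x _; rewrite powR_inv1 ?sqr_ge0//.
  by have [->|x0] := eqVneq x 0; [rewrite mul0r invr0|field].
apply: measurable_funM => //.
by apply: (measurableT_comp (measurable_powR _)); exact: measurable_funX.
Qed.

Lemma measurable_atan : measurable_fun [set: R] (@atan R).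
Proof. by apply: continuous_measurable_fun; exact: continuous_atan. Qed.

(** The defining existential over radius and angle is traded for an explicit test on abscissa and
    slope. The test ignores the slope on the vertical line, where it is only a default value. *)
Lemma measurable_polar_region : measurable (polar_region O r).
Proof.
pose x (p : R * R) := p.1 - O.1; pose y (p : R * R) := p.2 - O.2.
pose s p := y p / x p.
pose b p := if 0 < x p then x p <= r (atan (s p)) * cos (atan (s p))
  else if x p < 0 then - x p <= r (atan (s p) + pi) * cos (atan (s p))
  else (- r (- (pi / 2)) <= y p) && (y p <= r (pi / 2)).
have -> : polar_region O r = [set p | b p].
  apply/seteqP; suff E p : polar_region O r p <-> b p by split=> p /E.
  have yE : x p != 0 -> p = (O.1 + x p, O.2 + x p * s p).
    move=> x0; rewrite /s mulrC divfK// /x /y !(addrC O.1) !(addrC O.2) !subrK.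
    exact: surjective_pairing.
  have xE : x p = 0 -> p = (O.1, O.2 + y p).
    by rewrite /x /y (addrC O.2) subrK => /subr0_eq <-; exact: surjective_pairing.
  rewrite /b; have [x0|x0|x0] := ltrgt0P (x p).
  - by rewrite {1}yE ?gt_eqF// polar_region_right.
  - by rewrite {1}yE ?lt_eqF// polar_region_left.
  - by rewrite {1}xE// polar_region_vertical.
have mx : measurable_fun setT x by exact: measurable_funB.
have my : measurable_fun setT y by exact: measurable_funB.
have mr : measurable_fun [set: R] r by exact: continuous_measurable_fun.
have ms : measurable_fun setT s.
  by apply: measurable_funM => //; exact: (measurableT_comp measurable_inv).
have mt : measurable_fun setT (fun p => atan (s p)).
  exact: (measurableT_comp measurable_atan).
have mc : measurable_fun setT (fun p => cos (atan (s p))).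
  apply: (measurableT_comp _ mt).
  by apply: continuous_measurable_fun; exact: continuous_cos.
apply: measurable_pred; apply: measurable_fun_ifT; first exact: measurable_fun_ltr.
  apply: measurable_fun_ler => //; apply: measurable_funM => //.
  exact: (measurableT_comp mr).
apply: measurable_fun_ifT; first exact: measurable_fun_ltr.
  apply: measurable_fun_ler => //; first exact: measurable_funN.
  apply: measurable_funM => //; apply: (measurableT_comp mr).
  exact: measurable_funD.
by apply: measurable_and; exact: measurable_fun_ler.
Qed.

End polar_region_measurable.

(** * Integrals over slopes, evaluated by primitives in the angle *)

Section slope_integrals.
Context {R : realType}.
Notation mu := (@lebesgue_measure R).
Implicit Types (g G h : R -> R) (a b c s x : R).

(** [G \o atan] is a primitive of the integrand and tends to [G (pi / 2)] at infinity. *)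
Lemma integral_slope_right g G c : continuous g -> (forall t, 0 <= g t) ->
  (forall t : R, is_derive t 1 G (g t)) ->
  (\int[mu]_(s in `[c, +oo[) (g (atan s) / (1 + s ^+ 2))%:E =
   (G (pi / 2) - G (atan c))%:E)%E.
Proof.
move=> cg g0 dG; have cG := is_derive_continuous dG.
have dF (s : R) : is_derive s 1 (G \o @atan R) (g (atan s) / (1 + s ^+ 2)).
  exact: is_derive1_comp.
have cF := is_derive_continuous dF.
rewrite (@ge0_continuous_FTC2y _ _ (G \o @atan R) c (G (pi / 2)))//.
- by move=> s _; rewrite divr_ge0// addr_ge0// sqr_ge0.
- apply: continuous_subspaceT => s; apply: cvgM.
    exact: (continuous_comp (@continuous_atan _ s) (cg (atan s))).
  apply: cvgV; first by rewrite gt_eqF// ltr_pwDl// sqr_ge0.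
  by apply: cvgD; [exact: cvg_cst|exact: exprn_continuous].
- apply: (@cvg_comp _ _ _ (@atan R) G _ (nbhs (pi / 2 : R)) _); last exact: cG.
  exact (@cvgy_atan R).
- exact/cvg_at_right_filter/cF.
- by move=> s _; rewrite derive1E (@derive_val _ _ _ _ _ _ _ (dF s)).
Qed.

(** The reflection [s |-> - s] reduces this to the right-hand case, with [t |-> - G (- t)] as
    primitive. *)
Lemma integral_slope_left g G c : continuous g -> (forall t, 0 <= g t) ->
  (forall t : R, is_derive t 1 G (g t)) ->
  (\int[mu]_(s in `]-oo, c]) (g (atan s) / (1 + s ^+ 2))%:E =
   (G (atan c) - G (- (pi / 2)))%:E)%E.
Proof.
move=> cg g0 dG.
rewrite -[X in `]-oo, X]](opprK c) ge0_integration_by_substitutionNy; last 2 first.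
- apply: continuous_subspaceT => s; apply: cvgM.
    exact: (continuous_comp (@continuous_atan _ s) (cg (atan s))).
  apply: cvgV; first by rewrite gt_eqF// ltr_pwDl// sqr_ge0.
  by apply: cvgD; [exact: cvg_cst|exact: exprn_continuous].
- by move=> s _; rewrite divr_ge0// addr_ge0// sqr_ge0.
transitivity (\int[mu]_(s in `[(- c)%R, +oo[)
    ((g \o -%R) (atan s) / (1 + s ^+ 2))%:E)%E.
  by apply: eq_integral => s _; rewrite /= atanN sqrrN.
have dGN (t : R) : is_derive t 1 (fun t => - G (- t)) ((g \o -%R) t).
  have dGt := dG (- t).
  rewrite -[X in is_derive _ _ _ X]opprK; apply: is_deriveN.
  by rewrite -mulrN1; exact: is_derive1_comp.
rewrite (integral_slope_right _ _ _ dGN).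
- by rewrite atanN !opprK addrC.
- by move=> t; apply: continuous_comp; [exact: opp_continuous|exact: cg].
- by move=> t; exact: g0.
Qed.

(** The density may change at [c], as it does for a half-plane bounded by the line of slope [c]. The
    value at [c] is left free, a point being null. *)
Lemma integral_slope_split h g1 G1 g2 G2 c : measurable_fun setT h ->
  (forall s, 0 <= h s) ->
  continuous g1 -> (forall t, 0 <= g1 t) -> (forall t : R, is_derive t 1 G1 (g1 t)) ->
  continuous g2 -> (forall t, 0 <= g2 t) -> (forall t : R, is_derive t 1 G2 (g2 t)) ->
  (forall s, s < c -> h s = g1 (atan s) / (1 + s ^+ 2)) ->
  (forall s, c < s -> h s = g2 (atan s) / (1 + s ^+ 2)) ->
  (\int[mu]_s (h s)%:E =
    (G1 (atan c) - G1 (- (pi / 2)) + (G2 (pi / 2) - G2 (atan c)))%:E)%E.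
Proof.
move=> mh h0 cg1 g10 dG1 cg2 g20 dG2 h1 h2.
have mEh A : measurable_fun A (EFin \o h).
  by apply/measurable_EFinP; exact: measurable_funTS.
have meq A g : measurable A -> (forall s, A s -> h s = g (atan s) / (1 + s ^+ 2)) ->
    measurable_fun A (fun s => (g (atan s) / (1 + s ^+ 2))%:E).
  move=> mA hA; apply: eq_measurable_fun (mEh A) => s /[!inE] As.
  by rewrite /= hA.
rewrite -(itv_setU_setT true c) ge0_integral_setU//; first last.
- apply/disj_set2P; apply/seteqP; split=> // s [] /=.
  by rewrite !in_itv/= andbT => h3 h4; lra.
- by move=> s _; rewrite lee_fin.
- exact: mEh.
rewrite -[X in (_ + X)%E]integral_itv_obnd_cbnd; last exact: mEh.
rewrite (eq_integral (fun s : measurableTypeR R =>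
  (g1 (atan s) / (1 + s ^+ 2))%:E)); last first.
  by move=> s; rewrite inE/= in_itv/= => sc; rewrite h1.
rewrite integral_itv_bndo_bndc; last first.
  by apply: meq => // s; rewrite /= in_itv/= => sc; rewrite h1.
rewrite (integral_slope_left _ cg1 g10 dG1).
rewrite [X in (_ + X)%E](eq_integral (fun s : measurableTypeR R =>
  (g2 (atan s) / (1 + s ^+ 2))%:E)); last first.
  by move=> s; rewrite inE/= in_itv/= andbT => sc; rewrite h2.
rewrite integral_itv_obnd_cbnd; last first.
  by apply: meq => // s; rewrite /= in_itv/= andbT => sc; rewrite h2.
by rewrite (integral_slope_right _ cg2 g20 dG2).
Qed.

(** The integral of [|x|] from [0] to [a] is [a^2 / 2], which is where the density [r^2 / 2] comes
    from. The two segments are the parts of a line on either side of [O]. *)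
Lemma integral_abs_segments (A B a b : R) : 0 <= A -> 0 <= B -> 0 < a -> 0 < b ->
  (\int[mu]_x (`|x| * (A * \1_`[0, a] x + B * \1_`[- b, 0] x))%:E =
   (A * a ^+ 2 / 2 + B * b ^+ 2 / 2)%:E)%E.
Proof.
move=> A0 B0 a0 b0.
have seg (k c d : R) : c < d ->
    (\int[mu]_(x in `[c, d]) (k * x)%:E = (k * d ^+ 2 / 2 - k * c ^+ 2 / 2)%:E)%E.
  move=> cd; have dF (x : R) : is_derive x 1 (fun y => k * y ^+ 2 / 2) (k * x).
    have -> : (fun y => k * y ^+ 2 / 2) = (k / 2) \*: ((@id R) ^+ 2).
      by apply/funext => y; rewrite !fctE/= /GRing.scale/=; field.
    by apply: is_derive_eq; rewrite /GRing.scale/=; field.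
  have cF := is_derive_continuous dF.
  rewrite (@continuous_FTC2 _ _ (fun y => k * y ^+ 2 / 2))//.
  - by apply: continuous_subspaceT => x; exact: mulrl_continuous.
  - by split=> //; [exact: cvg_at_right_filter (cF _)|exact: cvg_at_left_filter (cF _)].
  - by move=> x _; rewrite derive1E (@derive_val _ _ _ _ _ _ _ (dF x)).
have mseg (C : R) (D : set R) : measurable D ->
    measurable_fun setT (fun x : R => (C * `|x| * \1_D x)%:E).
  move=> mD; apply/measurable_EFinP; apply: measurable_funM => //.
  by apply: measurable_funM => //; exact: normr_measurable.
under eq_integral.
  move=> x _; rewrite mulrDr !mulrA ![`|x| * _]mulrC EFinD; over.
rewrite ge0_integralD//=; first last.
- exact: mseg.
- by move=> x _; rewrite lee_fin !mulr_ge0.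
- exact: mseg.
- by move=> x _; rewrite lee_fin !mulr_ge0.
have cond (C : R) (D : set R) : (\int[mu]_x (C * `|x| * \1_D x)%:E =
    \int[mu]_(x in D) (C * `|x|)%:E)%E.
  rewrite [RHS]integral_mkcond; apply: eq_integral => x _.
  by rewrite epatch_indic/= EFinM.
rewrite !cond EFinD; congr (_ + _)%E.
- rewrite (eq_integral (fun x : measurableTypeR R => (A * x)%:E)) => [|x]; last first.
    by rewrite inE/= in_itv/= => /andP[x0 _]; rewrite ger0_norm.
  by rewrite seg//; congr EFin; ring.
- rewrite (eq_integral (fun x : measurableTypeR R => (- B * x)%:E)) => [|x]; last first.
    by rewrite inE/= in_itv/= => /andP[_ x0]; rewrite ler0_norm// mulrN mulNr.
  by rewrite seg ?oppr_lt0//; congr EFin; ring.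
Qed.

End slope_integrals.

Section polar_region_integrals.
Context {R : realType}.
Notation mu := (@lebesgue_measure R).
Variables (O : R * R) (r : R -> R).
Hypotheses (r_pos : forall th, 0 < r th) (r_cont : continuous r)
  (r_per : forall th, r (th + 2 * pi) = r th).
Let D := polar_region O r.
Let f t := r t ^+ 2 / 2.

Let mD : measurable D. Proof. exact: measurable_polar_region. Qed.

Let f0 t : 0 <= f t. Proof. by rewrite divr_ge0// sqr_ge0. Qed.

Lemma continuous_sector_density : continuous (fun t => r t ^+ 2 / 2).
Proof.
move=> t; apply: cvgM; last exact: cvg_cst.
by apply: (@cvgM _ _ _ _ r r); exact: r_cont.
Qed.

(** Through this the squared fibre length [(r * cos (atan s))^2] carries the factor [1 / (1 + s^2)],
    the derivative of [atan]. *)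
Lemma cos_atan_sqr (s : R) : cos (atan s) ^+ 2 = (1 + s ^+ 2)^-1.
Proof.
by rewrite -[in RHS](atanK s) -cos2_tan2 ?invrK// gt_eqF// cos_atan_gt0.
Qed.

(* In slope coordinates [(x, s) |-> O + (x, x s)] the fibre of the region over
   [s] is the segment cut out by the two opposite directions [atan s] and
   [atan s + pi], and the Jacobian is [|x|]. *)
Lemma integral_polar_region (phi : R * R -> \bar R) (psi1 psi2 : R -> R) :
  measurable_fun setT phi -> (forall p, (0 <= phi p)%E) ->
  (forall s, 0 <= psi1 s) -> (forall s, 0 <= psi2 s) ->
  (forall x s, 0 < x -> phi (O.1 + x, O.2 + x * s) = (psi1 s)%:E) ->
  (forall x s, x < 0 -> phi (O.1 + x, O.2 + x * s) = (psi2 s)%:E) ->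
  (\int[@area R]_(p in D) phi p = \int[mu]_s
    (psi1 s * (f (atan s) / (1 + s ^+ 2)) +
     psi2 s * (f (atan s + pi) / (1 + s ^+ 2)))%:E)%E.
Proof.
move=> mphi phi0 psi10 psi20 phi1 phi2.
rewrite integral_mkcond (@ge0_integral_slope _ O); last 2 first.
- apply/(measurable_restrictT _ mD); exact: (@measurable_funTS _ _ _ _ D phi).
- by move=> p; rewrite patchE; case: ifP.
apply: eq_integral => s _.
have c0 := cos_atan_gt0 s.
pose a t := r t * cos (atan s).
have a0 t : 0 < a t by rewrite mulr_gt0.
transitivity (\int[mu]_x (`|x| * (psi1 s * \1_`[0, a (atan s)] x +
    psi2 s * \1_`[- a (atan s + pi), 0] x))%:E)%E; last first.
  rewrite integral_abs_segments//; congr EFin.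
  rewrite /a /f !exprMn cos_atan_sqr; field.
  by rewrite gt_eqF// ltr_pwDl// sqr_ge0.
apply: eq_integral => x _; rewrite patchE EFinM.
have [x0|x0|->] := ltrgt0P x; last by rewrite !mul0e.
- congr (_ * _)%E; rewrite phi1// !indicE.
  rewrite [_ \in `[- _, _]%classic]memNset ?mulr0 ?addr0; last first.
    by rewrite /= in_itv/= => /andP[_ x0']; lra.
  case: ifPn => [|/negP xD].
    rewrite inE => /(polar_region_right _ r_per s x0).1 xa.
    by rewrite mem_set ?mulr1//= in_itv/= ltW.
  rewrite memNset ?mulr0//= in_itv/= => /andP[_ xa]; apply: xD.
  by rewrite inE; apply/polar_region_right.
- congr (_ * _)%E; rewrite phi2// !indicE.
  rewrite [_ \in `[0, _]%classic]memNset ?mulr0 ?add0r; last first.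
    by rewrite /= in_itv/= => /andP[x0' _]; lra.
  case: ifPn => [|/negP xD].
    rewrite inE => /(polar_region_left _ r_per s x0).1 xa.
    by rewrite mem_set ?mulr1//= in_itv/= lerNl xa ltW.
  rewrite memNset ?mulr0//= in_itv/= lerNl => /andP[xa _]; apply: xD.
  by rewrite inE; apply/polar_region_left.
Qed.

Variable K : R -> R.
Hypothesis dK : forall t : R, is_derive t 1 K (f t).

Lemma measurable_slope_density (g : R -> R) : continuous g ->
  measurable_fun [set: R] (fun s => g (atan s) / (1 + s ^+ 2)).
Proof.
move=> cg; apply: measurable_funM.
  by apply: (measurableT_comp _ measurable_atan); exact: continuous_measurable_fun.
apply: (measurableT_comp measurable_inv).
by apply: measurable_funD => //; exact: exprn_measurable.
Qed.

Let is_derive_Dpi (g G : R -> R) : (forall t : R, is_derive t 1 G (g t)) ->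
  forall t : R, is_derive t 1 (fun t => G (t + pi)) (g (t + pi)).
Proof. by move=> dG t; exact: is_derive_comp_shift. Qed.

Let continuous_Dpi (g : R -> R) : continuous g -> continuous (fun t => g (t + pi)).
Proof.
move=> cg t; apply: (@continuous_comp _ _ _ (fun t => t + pi) g); last exact: cg.
by apply: cvgD; [exact: cvg_id|exact: cvg_cst].
Qed.

Let atan0E : - (pi / 2) + pi = pi / 2 :> R. Proof. by field. Qed.
Let atan1E : pi / 2 + pi = 3 * pi / 2 :> R. Proof. by field. Qed.

(** Adding the contributions of the opposite directions [t] and [t + pi] leaves an integrand in
    [atan s] with primitive [M t + M (t + pi)]. Its increment from [- (pi / 2)] to [pi / 2]
    telescopes to that of [M] over a full turn. *)
Lemma integral_polar_region_angle (phi : R * R -> \bar R) (g M : R -> R) :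
  measurable_fun setT phi -> (forall p, (0 <= phi p)%E) ->
  continuous g -> (forall t, 0 <= g t) ->
  (forall t : R, is_derive t 1 M (g t * f t)) ->
  (forall x s, 0 < x -> phi (O.1 + x, O.2 + x * s) = (g (atan s))%:E) ->
  (forall x s, x < 0 -> phi (O.1 + x, O.2 + x * s) = (g (atan s + pi))%:E) ->
  (\int[@area R]_(p in D) phi p = (M (3 * pi / 2) - M (- (pi / 2)))%:E)%E.
Proof.
move=> mphi phi0 cg g0 dM phi1 phi2; have cf := continuous_sector_density.
pose h t := g t * f t.
have ch : continuous h by move=> t; apply: cvgM; [exact: cg|exact: cf].
have h0 t : 0 <= h t by rewrite mulr_ge0.
pose H t := h t + h (t + pi); pose G t := M t + M (t + pi).
have cH : continuous H.
  by move=> t; apply: cvgD; [exact: ch|exact: (continuous_Dpi ch)].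
have H0 t : 0 <= H t by rewrite addr_ge0.
have dG (t : R) : is_derive t 1 G (H t).
  by apply: is_deriveD; exact: (is_derive_Dpi dM).
rewrite (integral_polar_region (psi1 := fun s => g (atan s))
  (psi2 := fun s => g (atan s + pi)))//.
transitivity (\int[mu]_s (H (atan s) / (1 + s ^+ 2))%:E)%E.
  by apply: eq_integral => s _; congr EFin; rewrite /H /h; ring.
(* The same density holds on both sides, so the cut at slope [0] is arbitrary. *)
rewrite (@integral_slope_split _ _ H G H G 0)//.
- by congr EFin; rewrite /G atan0E atan1E; ring.
- exact: measurable_slope_density.
- by move=> s; rewrite divr_ge0// addr_ge0// sqr_ge0.
Qed.

Lemma area_polar_region : @area R D = (K (3 * pi / 2) - K (- (pi / 2)))%:E.
Proof.
transitivity (\int[@area R]_(p in D) cst 1%E p)%E.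
  by rewrite integral_cst ?mul1e//; exact: mD.
apply: (integral_polar_region_angle (g := cst 1)) => //.
- exact: cst_continuous.
- by move=> t; rewrite mul1r.
Qed.

(** Twice the signed area of the triangle [O], [a], [b]; it is positive exactly when [b] lies
    strictly to the left of the directed line from [O] through [a]. *)
Definition cross (a b : R * R) :=
  (a.1 - O.1) * (b.2 - O.2) - (a.2 - O.2) * (b.1 - O.1).

Lemma cross_slope x s x' s' :
  cross (O.1 + x, O.2 + x * s) (O.1 + x', O.2 + x' * s') = x * x' * (s' - s).
Proof. by rewrite /cross /=; ring. Qed.

Lemma measurable_cross d (T : measurableType d) (u v : T -> R * R) :
  measurable_fun setT u -> measurable_fun setT v ->
  measurable_fun setT (fun x => cross (u x) (v x)).
Proof.
move=> mu_ mv.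
by apply: measurable_funB; apply: measurable_funM; apply: measurable_funB => //;
  exact: measurableT_comp.
Qed.

Hypothesis K_period : forall t, K (t + 2 * pi) = K t + 1.

Let half_plane a : R * R -> \bar R := EFin \o \1_[set b | 0 < cross a b].

Let measurable_half_plane a : measurable_fun setT (half_plane a).
Proof.
apply/measurable_EFinP; apply: measurable_indic; apply: measurable_pred.
by apply: measurable_fun_ltr => //; exact: measurable_cross.
Qed.

Let half_plane_ge0 a p : (0 <= half_plane a p)%E.
Proof. by rewrite lee_fin. Qed.

Let half_plane_slope x s x' s' :
  half_plane (O.1 + x, O.2 + x * s) (O.1 + x', O.2 + x' * s') =
  ((0 < x * x' * (s' - s))%R%:R)%:E.
Proof.
rewrite /half_plane /= indicE -cross_slope; congr ((nat_of_bool _)%:R%:E).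
by apply/idP/idP; rewrite inE.
Qed.

Let cf := continuous_sector_density.
Let dKpi := is_derive_Dpi dK.
Let cfpi := continuous_Dpi cf.

Lemma measurable_polar_step (b1 b2 : R -> bool) :
  measurable_fun setT b1 -> measurable_fun setT b2 ->
  measurable_fun setT (fun s : R =>
    (b1 s)%:R * (f (atan s) / (1 + s ^+ 2)) +
    (b2 s)%:R * (f (atan s + pi) / (1 + s ^+ 2))).
Proof.
move=> mb1 mb2.
have mb (b : R -> bool) : measurable_fun setT b ->
    measurable_fun [set: R] (fun s => (b s)%:R : R).
  move=> mb; rewrite (_ : (fun s => _) = (fun s => if b s then 1 else 0)).
    exact: measurable_fun_ifT.
  by apply/funext => s; case: (b s).
apply: measurable_funD; apply: measurable_funM; rewrite ?mb//.
- exact: mb.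
- exact: (measurable_slope_density cf).
- exact: mb.
- exact: (measurable_slope_density cfpi).
Qed.

Lemma polar_step_ge0 (b1 b2 : bool) (s : R) :
  0 <= b1%:R * (f (atan s) / (1 + s ^+ 2)) +
       b2%:R * (f (atan s + pi) / (1 + s ^+ 2)).
Proof.
have s0 : 0 <= 1 + s ^+ 2 by rewrite addr_ge0// sqr_ge0.
by rewrite addr_ge0// mulr_ge0// divr_ge0.
Qed.

(** To the right of [O] the half-plane contains the slopes above [s], to the left of [O] those below
    [s]. The two sectors meet at the angle [pi / 2]. *)
Lemma area_half_plane_right (x s : R) : 0 < x ->
  (\int[@area R]_(b in D) half_plane (O.1 + x, O.2 + x * s)%R b =
   (K (atan s + pi) - K (atan s))%:E)%E.
Proof.
move=> x0.
rewrite (integral_polar_region (psi1 := fun s' => (s < s')%R%:R)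
  (psi2 := fun s' => (s' < s)%R%:R))//.
- have mh : measurable_fun setT (fun s' : R =>
      (s < s')%R%:R * (f (atan s') / (1 + s' ^+ 2)) +
      (s' < s)%R%:R * (f (atan s' + pi) / (1 + s' ^+ 2))).
    by apply: (measurable_polar_step (b1 := fun s' => s < s') (b2 := fun s' => s' < s));
      exact: measurable_fun_ltr.
  apply: etrans.
    apply: (integral_slope_split mh (fun s' => polar_step_ge0 _ _ s')
      cfpi (fun t => f0 (t + pi)) dKpi cf f0 dK (c := s)) => // s' ss'.
      by rewrite ss' ltNge (ltW ss') mul0r mul1r add0r.
    by rewrite ss' ltNge (ltW ss') mul0r mul1r addr0.
  by congr EFin; rewrite atan0E; ring.
- move=> x' s' x'0; rewrite half_plane_slope pmulr_rgt0 ?subr_gt0//.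
  exact: mulr_gt0.
- move=> x' s' x'0; rewrite half_plane_slope nmulr_rgt0 ?subr_lt0//.
  by rewrite pmulr_rlt0.
Qed.

(** Here the two sectors meet at [3 * pi / 2], an angle that the other sector reaches as
    [- (pi / 2)]; [K_period] bridges this jump. *)
Lemma area_half_plane_left (x s : R) : x < 0 ->
  (\int[@area R]_(b in D) half_plane (O.1 + x, O.2 + x * s)%R b =
   (K (atan s + pi + pi) - K (atan s + pi))%:E)%E.
Proof.
move=> x0.
rewrite (integral_polar_region (psi1 := fun s' => (s' < s)%R%:R)
  (psi2 := fun s' => (s < s')%R%:R))//.
- have mh : measurable_fun setT (fun s' : R =>
      (s' < s)%R%:R * (f (atan s') / (1 + s' ^+ 2)) +
      (s < s')%R%:R * (f (atan s' + pi) / (1 + s' ^+ 2))).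
    by apply: (measurable_polar_step (b1 := fun s' => s' < s) (b2 := fun s' => s < s'));
      exact: measurable_fun_ltr.
  apply: etrans.
    apply: (integral_slope_split mh (fun s' => polar_step_ge0 _ _ s')
      cf f0 dK cfpi (fun t => f0 (t + pi)) dKpi (c := s)) => // s' ss'.
      by rewrite ss' ltNge (ltW ss') mul0r mul1r addr0.
    by rewrite ss' ltNge (ltW ss') mul0r mul1r add0r.
  congr EFin; have := K_period (- (pi / 2)); have := K_period (atan s).
  rewrite (_ : atan s + 2 * pi = atan s + pi + pi); last by ring.
  rewrite (_ : - (pi / 2) + 2 * pi = pi / 2 + pi); last by field.
  by move=> h1 h2; lra.
- move=> x' s' x'0; rewrite half_plane_slope nmulr_rgt0 ?subr_lt0//.
  by rewrite nmulr_rlt0.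
- move=> x' s' x'0; rewrite half_plane_slope pmulr_rgt0 ?subr_gt0//.
  by rewrite nmulr_rgt0.
Qed.

End polar_region_integrals.

(** * The triangle event *)

Section triangle_sign_criterion.
Context {R : realType}.
Variable O : R * R.
Implicit Types a b c : R * R.

Definition dot a b := (a.1 - O.1) * (b.1 - O.1) + (a.2 - O.2) * (b.2 - O.2).

Lemma cross_antisym a b : cross O b a = - cross O a b.
Proof. by rewrite /cross; ring. Qed.

Lemma dotC a b : dot b a = dot a b.
Proof. by rewrite /dot; ring. Qed.

Lemma in_triangle_rot a b c : in_triangle O a b c -> in_triangle O b c a.
Proof.
move=> [al [be [ga [al0 [be0 [ga0 [sum [e1 e2]]]]]]]].
by exists be, ga, al; rewrite e1 e2; do !split=> //; rewrite -?sum; ring.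
Qed.

Lemma in_triangle_segment a b c :
  cross O a b = 0 -> dot a b <= 0 -> in_triangle O a b c.
Proof.
move=> cab dab.
(* [n] is the squared distance from [a] to [b]. If it is zero, then [dot a b <= 0] forces
   [a = O]. *)
pose n := dot a a + dot b b - 2 * dot a b.
have sqr_dot x : 0 <= dot x x by rewrite addr_ge0// -expr2 sqr_ge0.
have [n0|n0] := eqVneq n 0.
  have aa : dot a a = 0 by have := sqr_dot a; have := sqr_dot b; rewrite /n in n0; lra.
  have a1 : a.1 - O.1 = 0.
    by apply/eqP; rewrite -sqrf_eq0 expr2; apply/eqP; move: aa; rewrite /dot;
      have := sqr_ge0 (a.1 - O.1); have := sqr_ge0 (a.2 - O.2); rewrite !expr2; lra.
  have a2 : a.2 - O.2 = 0.
    by apply/eqP; rewrite -sqrf_eq0 expr2; apply/eqP; move: aa; rewrite /dot;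
      have := sqr_ge0 (a.1 - O.1); have := sqr_ge0 (a.2 - O.2); rewrite !expr2; lra.
  by exists 1, 0, 0; rewrite ler01 lexx; do !split=> //; lra.
have n_gt0 : 0 < n.
  rewrite lt0r n0 /n; have := sqr_dot a; have := sqr_dot b; lra.
(* Weights of the foot of the perpendicular from [O] to the line through [a] and [b]; this foot
   differs from [O] by a multiple of [cross O a b]. *)
exists ((dot b b - dot a b) / n), ((dot a a - dot a b) / n), 0.
have ca : 0 <= dot b b - dot a b by rewrite subr_ge0 (le_trans dab).
have cb : 0 <= dot a a - dot a b by rewrite subr_ge0 (le_trans dab).
do !split; rewrite ?lexx ?divr_ge0// ?ltW//.
- by rewrite addr0 -mulrDl -(divff n0); congr (_ / _); rewrite /n; ring.
- have E : (dot b b - dot a b) * a.1 + (dot a a - dot a b) * b.1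
      = O.1 * n + cross O a b * (b.2 - a.2) by rewrite /n /dot /cross; ring.
  rewrite mul0r addr0 mulrAC (mulrAC _ _ b.1) -mulrDl E cab mul0r addr0.
  by rewrite mulfK.
- have E : (dot b b - dot a b) * a.2 + (dot a a - dot a b) * b.2
      = O.2 * n - cross O a b * (b.1 - a.1) by rewrite /n /dot /cross; ring.
  rewrite mul0r addr0 mulrAC (mulrAC _ _ b.2) -mulrDl E cab mul0r subr0.
  by rewrite mulfK.
Qed.

Definition triangle_test a b c :=
  let p := cross O a b in let q := cross O b c in let s := cross O c a in
  [|| [&& 0 <= p, 0 <= q, 0 <= s & 0 < p + q + s],
      [&& p <= 0, q <= 0, s <= 0 & p + q + s < 0],
      (p == 0) && (dot a b <= 0),
      (q == 0) && (dot b c <= 0) |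
      (s == 0) && (dot c a <= 0)].

(* Where the three areas [cross] do not sum to zero they are proportional to the
   barycentric coordinates of [O]; the remaining configurations are collinear
   and need the sign of the dot products. *)
Lemma in_triangleP a b c : in_triangle O a b c <-> triangle_test a b c.
Proof.
rewrite /triangle_test.
set p := cross O a b; set q := cross O b c; set s := cross O c a.
have bary : p + q + s != 0 -> 0 <= q / (p + q + s) -> 0 <= s / (p + q + s) ->
    0 <= p / (p + q + s) -> in_triangle O a b c.
  move=> S0 q0 s0 p0; exists (q / (p + q + s)), (s / (p + q + s)), (p / (p + q + s)).
  do !split=> //.
  - by rewrite -!mulrDl -(divff S0); congr (_ / _); ring.
  - rewrite !(mulrAC _ (_^-1)) -!mulrDl.
    rewrite (_ : q * a.1 + _ + _ = O.1 * (p + q + s)) ?mulfK//.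
    by rewrite /p /q /s /cross; ring.
  - rewrite !(mulrAC _ (_^-1)) -!mulrDl.
    rewrite (_ : q * a.2 + _ + _ = O.2 * (p + q + s)) ?mulfK//.
    by rewrite /p /q /s /cross; ring.
split; last first.
  case/or4P => [/and4P[p0 q0 s0 S0]|/and4P[p0 q0 s0 S0]|/andP[/eqP p0 d0]|].
  - by apply: bary; rewrite ?gt_eqF// divr_ge0// ltW.
  - by apply: bary; rewrite ?lt_eqF// -mulrNN mulr_ge0// ?oppr_ge0// invr_le0 ltW.
  - exact: in_triangle_segment.
  - case/orP => /andP[/eqP p0 d0].
      by apply: in_triangle_rot; apply: in_triangle_rot; exact: in_triangle_segment.
    by apply: in_triangle_rot; exact: in_triangle_segment.
move=> [al [be [ga [al0 [be0 [ga0 [sum [e1 e2]]]]]]]].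
have f1 : al * (a.1 - O.1) + be * (b.1 - O.1) + ga * (c.1 - O.1) = 0.
  rewrite (_ : _ + _ = al * a.1 + be * b.1 + ga * c.1 - (al + be + ga) * O.1).
    by rewrite -e1 sum mul1r subrr.
  by ring.
have f2 : al * (a.2 - O.2) + be * (b.2 - O.2) + ga * (c.2 - O.2) = 0.
  rewrite (_ : _ + _ = al * a.2 + be * b.2 + ga * c.2 - (al + be + ga) * O.2).
    by rewrite -e2 sum mul1r subrr.
  by ring.
have cross0 (x : R * R) : al * cross O x a + be * cross O x b + ga * cross O x c = 0.
  apply: etrans (_ : (x.1 - O.1) * 0 - (x.2 - O.2) * 0 = 0); last by ring.
  by rewrite -{1}f2 -f1 /cross; ring.
have dot0 (x : R * R) : al * dot x a + be * dot x b + ga * dot x c = 0.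
  apply: etrans (_ : (x.1 - O.1) * 0 + (x.2 - O.2) * 0 = 0); last by ring.
  by rewrite -{1}f1 -f2 /dot; ring.
have crossxx (x : R * R) : cross O x x = 0 by rewrite /cross; ring.
have := cross0 a; have := cross0 b; have := cross0 c.
rewrite !crossxx (cross_antisym a b) (cross_antisym b c) (cross_antisym c a).
rewrite -/p -/q -/s => h1 h2 h3.
(* Crossing the barycentric relation with each vertex makes [q], [s], [p] proportional to [al],
   [be], [ga], with ratio [p + q + s]. *)
have qE : al * (p + q + s) = q.
  rewrite -[RHS]mul1r -sum; lra.
have sE : be * (p + q + s) = s.
  rewrite -[RHS]mul1r -sum; lra.
have pE : ga * (p + q + s) = p.
  rewrite -[RHS]mul1r -sum; lra.
have [S0|S0|S0] := ltrgt0P (p + q + s).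
- have p0 : 0 <= p by rewrite -pE mulr_ge0// ltW.
  have q0 : 0 <= q by rewrite -qE mulr_ge0// ltW.
  have s0 : 0 <= s by rewrite -sE mulr_ge0// ltW.
  by rewrite p0 q0 s0.
- have p0 : p <= 0 by rewrite -pE mulr_ge0_le0// ltW.
  have q0 : q <= 0 by rewrite -qE mulr_ge0_le0// ltW.
  have s0 : s <= 0 by rewrite -sE mulr_ge0_le0// ltW.
  by rewrite p0 q0 s0 orbT.
(* All three crosses vanish here. If every dot product were positive, pairing the relation with [a]
   and with [b] under [dot] would make all weights zero, against their sum [1]. *)
move: pE qE sE; rewrite S0 !mulr0 => <- <- <-; rewrite eqxx /=.
have [//|ab0] := leP (dot a b) 0; rewrite ?orbT//.
have [//|bc0] := leP (dot b c) 0; rewrite ?orbT//.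
have [//|ca0] := leP (dot c a) 0; rewrite ?orbT//.
have aa0 : 0 <= dot a a by rewrite addr_ge0// -expr2 sqr_ge0.
exfalso; have := dot0 a; have := dot0 b.
rewrite (dotC a b) (dotC c a) => g1 g2.
have bb0 : 0 <= dot b b by rewrite addr_ge0// -expr2 sqr_ge0.
have n1 := mulr_ge0 al0 aa0; have n2 := mulr_ge0 be0 (ltW ab0).
have n3 := mulr_ge0 ga0 (ltW ca0); have n4 := mulr_ge0 al0 (ltW ab0).
have n5 := mulr_ge0 be0 bb0; have n6 := mulr_ge0 ga0 (ltW bc0).
have zero (k y : R) : 0 < y -> k * y = 0 -> k = 0.
  by move=> y0 /eqP; rewrite mulf_eq0 (gt_eqF y0) orbF => /eqP.
have be_eq0 : be = 0 by apply: (zero _ (dot a b)) => //; lra.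
have ga_eq0 : ga = 0 by apply: (zero _ (dot c a)) => //; lra.
have al_eq0 : al = 0 by apply: (zero _ (dot a b)) => //; lra.
by move: sum; rewrite be_eq0 ga_eq0 al_eq0; lra.
Qed.

End triangle_sign_criterion.

(** * Probabilities of the sign patterns of the three cross products *)

Section triangle_probability.
Context {R : realType}.
Notation mu := (@lebesgue_measure R).
Variables (O : R * R) (r : R -> R).
Hypotheses (r_pos : forall th, 0 < r th) (r_cont : continuous r)
  (r_per : forall th, r (th + 2 * pi) = r th).
Let D := polar_region O r.
Hypothesis area1 : @area R D = 1%E.
Variables K M : R -> R.
Hypotheses (dK : forall t : R, is_derive t 1 K (r t ^+ 2 / 2))
  (K_period : forall t, K (t + 2 * pi) = K t + 1)
  (dM : forall t : R, is_derive t 1 M (half_turn K t ^+ 2 * (r t ^+ 2 / 2))).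

Let m : {sigma_finite_measure
    set (measurableTypeR R * measurableTypeR R)%type -> \bar R} :=
  product_sigma_finite_measure mu mu.
Let mD : measurable D. Proof. exact: measurable_polar_region. Qed.

Let ind (A : set (R * R)) : R * R -> \bar R := EFin \o \1_A.
Let mind A : measurable A -> measurable_fun setT (ind A).
Proof. by move=> mA; apply/measurable_EFinP; exact: measurable_indic. Qed.
Let ind0 A p : (0 <= ind A p)%E. Proof. by rewrite lee_fin. Qed.

Let inside (b : R -> R -> R -> bool) : set ((R * R) * (R * R) * (R * R)) :=
  ((D `*` D) `*` D) `&` [set x | b (cross O x.1.1 x.1.2) (cross O x.1.2 x.2)
                                   (cross O x.2 x.1.1)].

(** Its integral over the second point is the probability, given the first, that their cross product
    passes the test [c]. *)
Let fiber (c : R -> bool) (z : (R * R) * (R * R)) : \bar R :=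
  (ind D z.2 * ((c (cross O z.1 z.2))%:R)%:E)%E.

Let measurable_test d (T : measurableType d) (c : R -> bool) (u v : T -> R * R) :
  measurable_fun setT c -> measurable_fun setT u -> measurable_fun setT v ->
  measurable_fun setT (fun x => ((c (cross O (u x) (v x)))%:R : R)%:E).
Proof.
move=> mc mu_ mv; apply/measurable_EFinP.
rewrite (_ : (fun x => _) = (fun x => if c (cross O (u x) (v x)) then 1 else 0)).
  by apply: measurable_fun_ifT => //; apply: (measurableT_comp mc);
    exact: measurable_cross.
by apply/funext => z; case: (c _).
Qed.

Let measurable_fiber c : measurable_fun setT c -> measurable_fun setT (fiber c).
Proof.
move=> mc; apply: emeasurable_funM.
  by apply: (measurableT_comp (mind mD)).
exact: measurable_test.
Qed.

Let fiber_ge0 c z : (0 <= fiber c z)%E.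
Proof. by rewrite mule_ge0// lee_fin. Qed.

Let fiberE c a : fubini_F m (fiber c) a =
  (\int[m]_(b in D) ((c (cross O a b))%:R)%:E)%E.
Proof.
rewrite integral_mkcond /fubini_F; apply: eq_integral => b _.
by rewrite epatch_indic muleC.
Qed.

Let fiber_true a : fubini_F m (fiber xpredT) a = 1%E.
Proof. by rewrite fiberE integral_cst ?mul1e//; exact: area1. Qed.

Let fiber_gt0 (a : R * R) : fubini_F m (fiber (fun y => 0 < y)) a =
  (\int[@area R]_(b in D) (EFin \o \1_[set b | (0 < cross O a b)%R]) b)%E.
Proof.
rewrite fiberE; apply: eq_integral => b _; rewrite /= indicE.
by congr ((nat_of_bool _)%:R%:E); apply/idP/idP; rewrite inE.
Qed.

Let test_gt0 : measurable_fun [set: R] (fun y => 0 < y).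
Proof. exact: measurable_fun_ltr. Qed.

Let test_eq0 : measurable_fun [set: R] (fun y => y == 0).
Proof. exact: measurable_fun_eqr. Qed.

(** Points aligned with [O] and the given point share the slope [s], and the integrand vanishes on
    both sides of that slope. *)
Let fiber_eq0 x s : x != 0 ->
  fubini_F m (fiber (fun y => y == 0)) (O.1 + x, O.2 + x * s) = 0%E.
Proof.
move=> x0; rewrite fiberE.
pose psi s' : R := (s' == s)%:R.
have E x' s' : x' != 0 ->
    ((cross O (O.1 + x, O.2 + x * s) (O.1 + x', O.2 + x' * s') == 0)%:R)%:E
    = (psi s')%:E.
  move=> x'0; rewrite cross_slope !mulf_eq0 (negbTE x0) (negbTE x'0) /=.
  by rewrite subr_eq0.
rewrite (@integral_polar_region _ O r _ _ _ _ psi psi)//.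
- apply: etrans.
    apply: (@integral_slope_split _ _ (cst 0) (cst 0) (cst 0) (cst 0) s) => //.
    + apply: (measurable_polar_step r_cont (b1 := fun s' => s' == s)
        (b2 := fun s' => s' == s)); exact: measurable_fun_eqr.
    + by move=> s'; exact: polar_step_ge0.
    + by move=> t; exact: cst_continuous.
    + by move=> t; exact: cst_continuous.
    + by move=> s' ss'; rewrite /psi lt_eqF// !mul0r addr0.
    + by move=> s' ss'; rewrite /psi gt_eqF// !mul0r addr0.
  by rewrite !subrr addr0.
- exact: (measurable_test test_eq0 (measurable_cst _) (@measurable_id _ _ _)).
- by move=> x' s' x'0; rewrite E// gt_eqF.
- by move=> x' s' x'0; rewrite E// lt_eqF.
Qed.

(** Its integral over [a] is the probability that the vertex [a] passes [c] with one of the other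
    points and, independently given [a], [c'] with the remaining one. *)
Let vertex_integral (c c' : R -> bool) (a : R * R) : \bar R :=
  (ind D a * fubini_F m (fiber c) a * fubini_F m (fiber c') a)%E.

Let vertex_integralE c c' : (\int[m]_a vertex_integral c c' a =
  \int[m]_(a in D) (fubini_F m (fiber c) a * fubini_F m (fiber c') a))%E.
Proof.
rewrite [RHS]integral_mkcond; apply: eq_integral => a _.
by rewrite epatch_indic /vertex_integral -muleA muleC.
Qed.

Let measurable_fubini_fiber c : measurable_fun setT c ->
  measurable_fun setT (fubini_F m (fiber c)).
Proof.
by move=> mc; apply: measurable_fun_fubini_tonelli_F => //; exact: measurable_fiber.
Qed.

Let fubini_fiber_ge0 c a : (0 <= fubini_F m (fiber c) a)%E.
Proof. exact: integral_ge0. Qed.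

Let vertex_integral_eq0 c c' : measurable_fun setT c -> measurable_fun setT c' ->
  (forall x s : R, x != 0 ->
    (fubini_F m (fiber c) (O.1 + x, O.2 + x * s)%R *
     fubini_F m (fiber c') (O.1 + x, O.2 + x * s)%R = 0)%E) ->
  (\int[m]_a vertex_integral c c' a = 0)%E.
Proof.
move=> mc mc' h; rewrite vertex_integralE.
apply: etrans.
  apply: (@integral_polar_region_angle _ O r r_pos r_cont r_per _ (cst 0) (cst 0)).
  - by apply: emeasurable_funM; exact: measurable_fubini_fiber.
  - by move=> p; rewrite mule_ge0.
  - exact: cst_continuous.
  - by [].
  - by move=> t; rewrite mul0r; exact: is_derive_cst.
  - by move=> x s x0; rewrite h// gt_eqF.
  - by move=> x s x0; rewrite h// lt_eqF.
by rewrite subrr.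
Qed.

Let vertex_integral_gt0 :
  (\int[m]_a vertex_integral (fun y => 0 < y)%R (fun y => 0 < y)%R a =
  (M (3 * pi / 2) - M (- (pi / 2)))%:E)%E.
Proof.
rewrite vertex_integralE.
have cK : continuous K by exact: is_derive_continuous dK.
apply: (@integral_polar_region_angle _ O r r_pos r_cont r_per _
  (fun t => half_turn K t ^+ 2)) => //.
- by apply: emeasurable_funM; exact: measurable_fubini_fiber.
- by move=> p; rewrite mule_ge0.
- have cH : continuous (half_turn K).
    exact: is_derive_continuous (is_derive_half_turn dK).
  by move=> t; apply: (@cvgM _ _ _ _ (half_turn K) (half_turn K)); exact: cH.
- by move=> t; exact: sqr_ge0.
- move=> x s x0; rewrite fiber_gt0.
  by rewrite (area_half_plane_right O r_pos r_cont r_per dK)// -EFinM expr2.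
- move=> x s x0; rewrite fiber_gt0.
  by rewrite (area_half_plane_left O r_pos r_cont r_per dK)// -EFinM expr2.
Qed.

Let triple := (m \x m \x m)%E.

Let measurable_cube : measurable ((D `*` D) `*` D).
Proof. by apply: measurableX => //; exact: measurableX. Qed.

Let cube1 : triple ((D `*` D) `*` D) = 1%E.
Proof.
have square1 : (m \x m)%E (D `*` D) = 1%E.
  rewrite product_measure1E; [|exact: mD..].
  by rewrite (_ : m D = 1%E) ?mule1//; exact: area1.
rewrite /triple product_measure1E//; last exact: measurableX.
rewrite -[RHS]mule1; congr (_ * _)%E; [exact: square1|exact: area1].
Qed.

Let measurable_inside b :
  measurable_fun setT (fun x : (R * R) * (R * R) * (R * R) =>
    b (cross O x.1.1 x.1.2) (cross O x.1.2 x.2) (cross O x.2 x.1.1)) ->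
  measurable (inside b).
Proof. by move=> mb; apply: measurableI => //; exact: measurable_pred. Qed.

Let insideE b x : (\1_(inside b) x : R) = \1_D x.1.1 * \1_D x.1.2 * \1_D x.2 *
  (b (cross O x.1.1 x.1.2) (cross O x.1.2 x.2) (cross O x.2 x.1.1))%:R.
Proof.
rewrite !indicE /inside in_setI !in_setX.
rewrite (_ : (x \in [set _ | _]) = b (cross O x.1.1 x.1.2) (cross O x.1.2 x.2)
  (cross O x.2 x.1.1)); last by apply/idP/idP; rewrite inE.
by rewrite -!natrM !mulnb.
Qed.

Let mc1 : measurable_fun setT (fun x : (R * R) * (R * R) * (R * R) =>
  cross O x.1.1 x.1.2).
Proof. by apply: measurable_cross; apply: measurableT_comp. Qed.
Let mc2 : measurable_fun setT (fun x : (R * R) * (R * R) * (R * R) =>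
  cross O x.1.2 x.2).
Proof. by apply: measurable_cross => //; apply: measurableT_comp. Qed.
Let mc3 : measurable_fun setT (fun x : (R * R) * (R * R) * (R * R) =>
  cross O x.2 x.1.1).
Proof. by apply: measurable_cross => //; apply: measurableT_comp. Qed.

Let mtest d (T : measurableType d) (c : R -> bool) (u : T -> R) :
  measurable_fun setT c -> measurable_fun setT u ->
  measurable_fun setT (fun x => c (u x)).
Proof. by move=> mc mu_; exact: (measurableT_comp mc). Qed.

Let mtestN d (T : measurableType d) (c : R -> bool) (u : T -> R) :
  measurable_fun setT c -> measurable_fun setT u ->
  measurable_fun setT (fun x => c (- u x)).
Proof.
by move=> mc mu_; apply: (measurableT_comp mc); exact: measurable_funN.
Qed.

Let triple_indic (A : set ((R * R) * (R * R) * (R * R))) : measurable A ->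
  triple A = (\int[m \x m \x m]_x (\1_A x : R)%:E)%E.
Proof. by move=> mA; exact (triple_product_indic m mA). Qed.

(** Seen from the first vertex, the other two have crosses [p] and [- s], since [cross] is
    antisymmetric and [s] runs from the third vertex to the first. The signs in [vertex2] and
    [vertex3] arise in the same way. *)
Let vertex1 c c' : measurable_fun setT c -> measurable_fun setT c' ->
  triple (inside (fun p q s => c p && c' (- s))) =
  (\int[m]_a vertex_integral c c' a)%E.
Proof.
move=> mc mc'; have mI : measurable (inside (fun p q s => c p && c' (- s))).
  by apply: measurable_inside; apply: measurable_and; [exact: mtest|exact: mtestN].
rewrite (triple_indic mI) -triple_product1//; first last.
- exact: measurable_fiber.
- exact: measurable_fiber.
- exact: mind.
apply: eq_integral => x _; rewrite insideE /fiber /ind /= -!EFinM -cross_antisym.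
by congr EFin; rewrite -mulnb natrM; ring.
Qed.

Let vertex2 c c' : measurable_fun setT c -> measurable_fun setT c' ->
  triple (inside (fun p q s => c (- p) && c' q)) =
  (\int[m]_a vertex_integral c c' a)%E.
Proof.
move=> mc mc'; have mI : measurable (inside (fun p q s => c (- p) && c' q)).
  by apply: measurable_inside; apply: measurable_and; [exact: mtestN|exact: mtest].
rewrite (triple_indic mI) -triple_product2//; first last.
- exact: measurable_fiber.
- exact: measurable_fiber.
- exact: mind.
apply: eq_integral => x _; rewrite insideE /fiber /ind /= -!EFinM -cross_antisym.
by congr EFin; rewrite -mulnb natrM; ring.
Qed.

Let vertex3 c c' : measurable_fun setT c -> measurable_fun setT c' ->
  triple (inside (fun p q s => c s && c' (- q))) =
  (\int[m]_a vertex_integral c c' a)%E.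
Proof.
move=> mc mc'; have mI : measurable (inside (fun p q s => c s && c' (- q))).
  by apply: measurable_inside; apply: measurable_and; [exact: mtest|exact: mtestN].
rewrite (triple_indic mI) -triple_product3//; first last.
- exact: measurable_fiber.
- exact: measurable_fiber.
- exact: mind.
apply: eq_integral => x _; rewrite insideE /fiber /ind /= -!EFinM -cross_antisym.
by congr EFin; rewrite -mulnb natrM; ring.
Qed.

Let degenerate : set ((R * R) * (R * R) * (R * R)) :=
  inside (fun p q s => [|| p == 0, q == 0 | s == 0]).

Let measurable_degenerate : measurable degenerate.
Proof.
apply: measurable_inside; apply: measurable_or; first exact: (mtest test_eq0 mc1).
by apply: measurable_or; [exact: (mtest test_eq0 mc2)|exact: (mtest test_eq0 mc3)].
Qed.

(** Union bound: each of the three alignments is a vertex event in which one test is equality to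
    zero and the other is trivial. *)
Let degenerate_eq0 : triple degenerate = 0%E.
Proof.
have mtrue : measurable_fun [set: R] (xpredT : R -> bool) by [].
have z1 : (\int[m]_a vertex_integral (eq_op^~ 0%R) xpredT a = 0)%E.
  by apply: vertex_integral_eq0 => // x s x0; rewrite fiber_eq0// mul0e.
have z2 : (\int[m]_a vertex_integral xpredT (eq_op^~ 0%R) a = 0)%E.
  by apply: vertex_integral_eq0 => // x s x0; rewrite fiber_eq0// mule0.
pose A1 := inside (fun p q s => (p == 0) && true).
pose A2 := inside (fun p q s => true && (q == 0)).
pose A3 := inside (fun p q s => (s == 0) && true).
have mA1 : measurable A1.
  by apply: measurable_inside; apply: measurable_and => //; exact: (mtest test_eq0 mc1).
have mA2 : measurable A2.
  by apply: measurable_inside; apply: measurable_and => //; exact: (mtest test_eq0 mc2).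
have mA3 : measurable A3.
  by apply: measurable_inside; apply: measurable_and => //; exact: (mtest test_eq0 mc3).
apply/eqP; rewrite eq_le measure_ge0 andbT.
have U0 : (triple A1 + triple A2 + triple A3 = 0)%E.
  rewrite (vertex1 (c := eq_op^~ 0) (c' := xpredT))// z1.
  rewrite (vertex2 (c := xpredT) (c' := eq_op^~ 0))// z2.
  by rewrite (vertex3 (c := eq_op^~ 0) (c' := xpredT))// z1 !adde0.
rewrite -[leRHS]U0; apply: (@le_trans _ _ (triple (A1 `|` A2 `|` A3))).
  apply: le_measure; rewrite ?inE//.
    by apply: measurableU => //; exact: measurableU.
  move=> x [Dx /= /or3P[h|h|h]].
  - by left; left; split=> //=; rewrite h.
  - by left; right.
  - by right; split=> //=; rewrite h.
apply: le_trans (measureU2 _ _ _) _ => //; first exact: measurableU.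
by apply: leeD => //; exact: measureU2.
Qed.

Let eq_off_degenerate (A B : set ((R * R) * (R * R) * (R * R))) :
  measurable A -> measurable B ->
  (forall x, ~ degenerate x -> A x <-> B x) -> triple A = triple B.
Proof.
move=> mA mB AB.
have le (A' B' : set ((R * R) * (R * R) * (R * R))) : measurable A' -> measurable B' ->
    (forall x, ~ degenerate x -> A' x -> B' x) -> (triple A' <= triple B')%E.
  move=> mA' mB' h.
  have -> : triple B' = (triple B' + triple degenerate)%E.
    by rewrite degenerate_eq0 adde0.
  apply: (@le_trans _ _ (triple (B' `|` degenerate))); last exact: measureU2.
  apply: le_measure; rewrite ?inE//; first exact: measurableU.
  by move=> x A'x; have [dx|dx] := pselect (degenerate x); [right|left; exact: h].
apply: le_anti; apply/andP; split.
- by apply: le => // x ndx; exact: (AB x ndx).1.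
- by apply: le => // x ndx; exact: (AB x ndx).2.
Qed.

Let triple_setU (A B : set ((R * R) * (R * R) * (R * R))) :
  measurable A -> measurable B -> A `&` B = set0 ->
  triple (A `|` B) = (triple A + triple B)%E.
Proof. by move=> mA mB AB; exact: measureU. Qed.

Let insideU b1 b2 :
  (forall p q s, ~~ (b1 p q s && b2 p q s)) ->
  measurable (inside b1) -> measurable (inside b2) ->
  triple (inside (fun p q s => b1 p q s || b2 p q s)) =
  (triple (inside b1) + triple (inside b2))%E.
Proof.
move=> b12 m1 m2; rewrite (_ : inside _ = inside b1 `|` inside b2).
  apply: triple_setU => //; apply/seteqP; split=> // x [[_ /= h1] [_ /= h2]].
  have := b12 (cross O x.1.1 x.1.2) (cross O x.1.2 x.2) (cross O x.2 x.1.1).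
  by rewrite h1 h2.
apply/seteqP; split=> x /=.
  by move=> [Dx /orP[h|h]]; [left|right].
by move=> [[Dx h]|[Dx h]]; split=> //=; rewrite h ?orbT.
Qed.

Let measurable_dot d (T : measurableType d) (u v : T -> R * R) :
  measurable_fun setT u -> measurable_fun setT v ->
  measurable_fun setT (fun x => dot O (u x) (v x)).
Proof.
move=> mu_ mv.
by apply: measurable_funD; apply: measurable_funM; apply: measurable_funB => //;
  exact: measurableT_comp.
Qed.

Let triangle_set : set ((R * R) * (R * R) * (R * R)) :=
  [set x | D x.1.1 /\ D x.1.2 /\ D x.2 /\ in_triangle O x.1.1 x.1.2 x.2].

(** Replaces the existential over weights by a Boolean test, a form in which the event is visibly
    measurable. *)
Let triangle_setE : triangle_set =
  ((D `*` D) `*` D) `&` [set x | triangle_test O x.1.1 x.1.2 x.2].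
Proof.
apply/seteqP; split=> x /=.
  by move=> [? [? [? /in_triangleP ?]]].
by move=> [[[? ?] ?] ?]; do !split=> //; apply/in_triangleP.
Qed.

Let measurable_triangle_set : measurable triangle_set.
Proof.
rewrite triangle_setE; apply: measurableI => //; apply: measurable_pred.
have m11 : measurable_fun setT (fun x : (R * R) * (R * R) * (R * R) => x.1.1).
  exact: measurableT_comp.
have m12 : measurable_fun setT (fun x : (R * R) * (R * R) * (R * R) => x.1.2).
  exact: measurableT_comp.
have mS : measurable_fun setT (fun x : (R * R) * (R * R) * (R * R) =>
    cross O x.1.1 x.1.2 + cross O x.1.2 x.2 + cross O x.2 x.1.1).
  by apply: measurable_funD => //; exact: measurable_funD.
rewrite /triangle_test; repeat (apply: measurable_or || apply: measurable_and);
  solve [exact: measurable_fun_ler | exact: measurable_fun_ltr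
  | exact: measurable_fun_eqr
  | by apply: measurable_fun_ler => //; exact: measurable_dot].
Qed.

(* Off a null set the three areas [p], [q], [s] are nonzero. Either they have
   the same sign, which is the event that [O] is in the triangle, or for exactly
   one vertex the other two vertices lie on its left-hand side. *)
Lemma triangle_prob_sector :
  triangle_prob O (polar_region O r) =
  (1 - 3 * (M (3 * pi / 2) - M (- (pi / 2))))%:E.
Proof.
pose same (p q s : R) :=
  [&& 0 < p, 0 < q & 0 < s] || [&& 0 < - p, 0 < - q & 0 < - s].
(* Read cyclically, nonzero [p], [q], [s] of mixed signs pass from negative to positive exactly
   once. [bA], [bB], [bC] locate this passage ([s] to [p], [p] to [q], [q] to [s]), that is, the
   vertex with both others on its left. *)
pose bA (p q s : R) := (0 < p) && (0 < - s).
pose bB (p q s : R) := (0 < - p) && (0 < q).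
pose bC (p q s : R) := (0 < s) && (0 < - q).
have dBC p q s : ~~ (bB p q s && bC p q s).
  by apply/negP => /andP[/andP[h1 h2] /andP[h3 h4]]; lra.
have dABC p q s : ~~ (bA p q s && (bB p q s || bC p q s)).
  apply/negP => /andP[/andP[h1 h2] /orP[/andP[h3 h4]|/andP[h3 h4]]];
    by move: h1 h2 h3 h4; lra.
have dsame p q s : ~~ (same p q s && [|| bA p q s, bB p q s | bC p q s]).
  apply/negP => /andP[/orP[/and3P[h1 h2 h3]|/and3P[h1 h2 h3]]
      /or3P[/andP[h4 h5]|/andP[h4 h5]|/andP[h4 h5]]];
    by move: h1 h2 h3 h4 h5; lra.
have cover p q s : p != 0 -> q != 0 -> s != 0 ->
    [|| same p q s, bA p q s, bB p q s | bC p q s].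
  rewrite /same /bA /bB /bC !oppr_gt0.
  by case: (ltrgt0P p) => //; case: (ltrgt0P q) => //; case: (ltrgt0P s).
have mbA : measurable (inside bA).
  by apply: measurable_inside; apply: measurable_and;
    [exact: (mtest test_gt0 mc1)|exact: (mtestN test_gt0 mc3)].
have mbB : measurable (inside bB).
  by apply: measurable_inside; apply: measurable_and;
    [exact: (mtestN test_gt0 mc1)|exact: (mtest test_gt0 mc2)].
have mbC : measurable (inside bC).
  by apply: measurable_inside; apply: measurable_and;
    [exact: (mtest test_gt0 mc3)|exact: (mtestN test_gt0 mc2)].
have mor b1 b2 : measurable (inside b1) -> measurable (inside b2) ->
    measurable (inside (fun p q s => b1 p q s || b2 p q s)).
  move=> m1 m2; rewrite (_ : inside _ = inside b1 `|` inside b2).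
    exact: measurableU.
  apply/seteqP; split=> x /=.
    by move=> [Dx /orP[h|h]]; [left|right].
  by move=> [[Dx h]|[Dx h]]; split=> //=; rewrite h ?orbT.
have msame : measurable (inside same).
  apply: measurable_inside; apply: measurable_or; apply: measurable_and.
  - exact: (mtest test_gt0 mc1).
  - by apply: measurable_and; [exact: (mtest test_gt0 mc2)|exact: (mtest test_gt0 mc3)].
  - exact: (mtestN test_gt0 mc1).
  - by apply: measurable_and; [exact: (mtestN test_gt0 mc2)|exact: (mtestN test_gt0 mc3)].
have nondegenerate x : ~ degenerate x -> ((D `*` D) `*` D) x ->
    [/\ cross O x.1.1 x.1.2 != 0, cross O x.1.2 x.2 != 0 & cross O x.2 x.1.1 != 0].
  move=> ndx Dx; apply/and3P; rewrite -!negb_or; apply/negP => h.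
  by apply: ndx; split.
have Psame : triangle_prob O (polar_region O r) = triple (inside same).
  (* [m] is [area] repackaged with its sigma-finite structure, so [triple] and [area3] agree by
     computation. *)
  transitivity (triple triangle_set); first exact (erefl _).
  apply: eq_off_degenerate => // x ndx; rewrite triangle_setE.
  split=> -[Dx /= h]; split=> //=; have [p0 q0 s0] := nondegenerate _ ndx Dx.
    move: h p0 q0 s0; rewrite /triangle_test /same !oppr_gt0.
    by case: (ltrgt0P (cross O x.1.1 x.1.2)) => p0 //;
      case: (ltrgt0P (cross O x.1.2 x.2)) => q0 //;
      case: (ltrgt0P (cross O x.2 x.1.1)) => s0 //.
  rewrite /triangle_test; case/orP: h => /and3P[h1 h2 h3].
    by rewrite (ltW h1) (ltW h2) (ltW h3) (addr_gt0 (addr_gt0 h1 h2) h3).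
  move: h1 h2 h3; rewrite !oppr_gt0 => h1 h2 h3.
  have h4 : cross O x.1.1 x.1.2 + cross O x.1.2 x.2 + cross O x.2 x.1.1 < 0.
    by move: h1 h2 h3; lra.
  by rewrite (ltW h1) (ltW h2) (ltW h3) h4 orbT.
have total : (triple (inside same) + (triple (inside bA) +
    (triple (inside bB) + triple (inside bC))) = 1)%E.
  have mBC := mor _ _ mbB mbC; have mABC := mor _ _ mbA mBC.
  transitivity (triple (inside (fun p q s =>
      same p q s || (bA p q s || (bB p q s || bC p q s))))).
    apply/esym; apply: (etrans (insideU dsame msame mABC)).
    congr (_ + _)%E; apply: (etrans (insideU dABC mbA mBC)).
    by congr (_ + _)%E; exact: insideU.
  apply: (etrans _ cube1); apply: eq_off_degenerate; [exact: mor|exact: measurable_cube|].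
  move=> x ndx; split=> [h|Dx]; [exact: h.1|split; first exact: Dx].
  by have [p0 q0 s0] := nondegenerate _ ndx Dx; exact: cover.
move: total; rewrite Psame (vertex1 test_gt0 test_gt0) (vertex2 test_gt0 test_gt0).
rewrite (vertex3 test_gt0 test_gt0) vertex_integral_gt0 -!EFinD.
set I := M _ - M _; case: (triple _) => [x|//|//] [E].
by congr EFin; rewrite /I in E *; lra.
Qed.

End triangle_probability.

(** * The four formulas, from the increments of [L], [M] and [N] *)

Theorem theorem1p1 (R : realType) (O : R * R) (r : R -> R)
  (r_pos : forall th, 0 < r th)
  (r_cont : continuous r)
  (r_per : forall th, r (th + 2 * pi) = r th)
  (r_pw : piecewise_derivable r)
  (area1 : @area R (polar_region O r) = 1%E) :
  let P := triangle_prob O (polar_region O r) in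
  let H := Hfun r in
  (* (i) *)
  (forall thu : R, let thv := thu + pi in
     P = (- (Gfun r thu thv) ^+ 2 * (3 - 2 * Gfun r thu thv)
          + 6 * arc_int r (fun t => H t * (1 - H t)) thu thv)%:E) /\
  (* (ii) *)
  (forall thu : R, let thv := thu + pi in let x := Gfun r thu thv in
     P = (1 / 4 - (1 - 2 * x) ^+ 3 / 4
          - 6 * arc_int r (fun t => (1 / 2 - H t) ^+ 2) thu thv)%:E) /\
  (* (iii) *)
  (exists thu : R, let thv := thu + pi in
     P = (1 / 4 - 6 * arc_int r (fun t => (1 / 2 - H t) ^+ 2) thu thv)%:E) /\
  (* (iv) *)
  (P = (- (1 / 2) + 3 * arc_int r (fun t => H t * (1 - H t)) 0 (2 * pi))%:E /\
   P = (1 / 4 - 3 * arc_int r (fun t => (1 / 2 - H t) ^+ 2) 0 (2 * pi))%:E).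
Proof.
move=> P H.
pose f t := r t ^+ 2 / 2.
have cf : continuous f := continuous_sector_density r_cont.
have [K dK] := continuous_antiderivative cf.
have f_per t : f (t + 2 * pi) = f t by rewrite /f r_per.
have K_period t : K (t + 2 * pi) = K t + 1.
  (* The unit area fixes the increment of [K] over the turn starting at [- (pi / 2)]; periodicity of
     [f] carries it to every other start. *)
  have area_K : K (3 * pi / 2) - K (- (pi / 2)) = 1.
    have := area_polar_region O r_pos r_cont r_per dK; rewrite area1.
    by case.
  have dKd (u : R) : is_derive u 1 (fun v => K (v + 2 * pi) - K v) 0.
    rewrite -(subrr (f u)); apply: is_deriveB.
    by apply: is_derive_comp_shift; rewrite -f_per; exact: dK.
  have := is_derive_0_is_cst (f := fun v => K (v + 2 * pi) - K v) t (- (pi / 2)) dKd.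
  rewrite (_ : - (pi / 2) + 2 * pi = 3 * pi / 2); last by field.
  by rewrite area_K => h; lra.
pose h := half_turn K.
have dh := is_derive_half_turn dK.
have ch : continuous h := is_derive_continuous dh.
have cS : continuous (fun t => (1 / 2 - h t) ^+ 2 * f t).
  have c1 : continuous (fun t => 1 / 2 - h t).
    by move=> t; apply: cvgB; [exact: cvg_cst|exact: ch].
  move=> t; apply: cvgM; last exact: cf.
  by apply: (@cvgM _ _ _ _ (fun t => 1 / 2 - h t) (fun t => 1 / 2 - h t)); exact: c1.
have cM : continuous (fun t => h t ^+ 2 * f t).
  move=> t; apply: cvgM; last exact: cf.
  by apply: (@cvgM _ _ _ _ h h); exact: ch.
have cN : continuous (fun t => h t * (1 - h t) * f t).
  move=> t; apply: cvgM; last exact: cf.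
  apply: cvgM; first exact: ch.
  by apply: cvgB; [exact: cvg_cst|exact: ch].
have [L dL] := continuous_antiderivative cS.
have [M dM] := continuous_antiderivative cM.
have [N dN] := continuous_antiderivative cN.
have arcE (phi F : R -> R) a b : a < b -> continuous (fun t => phi t * f t) ->
    (forall t : R, is_derive t 1 F (phi t * f t)) -> arc_int r phi a b = F b - F a.
  by move=> ab cphi dF; exact: Rintegral_antiderivative.
have lt_pi (a : R) : a < a + pi by rewrite ltrDl pi_gt0.
have GE a : Gfun r a (a + pi) = h a.
  apply: (arcE (fun=> 1) K _ _ (lt_pi a)); last by move=> t; rewrite mul1r; exact: dK.
  by move=> t; apply: cvgM; [exact: cvg_cst|exact: cf].
have HE : H = h by apply/funext => t; exact: GE.
have PE : P = (1 - 3 * (M (3 * pi / 2) - M (- (pi / 2))))%:E.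
  exact: (triangle_prob_sector r_pos r_cont r_per area1 dK K_period dM).
(* The turn is moved to start at [u] and folded; the resulting polynomial in [h u] collapses to
   [1 / 4 - (1 - 2 * h u)^3 / 4]. *)
have P2 (u : R) : P = (1 / 4 - (1 - 2 * h u) ^+ 3 / 4 - 6 * (L (u + pi) - L u))%:E.
  rewrite PE; congr EFin.
  have := square_primitive_period K_period f_per dM u (- (pi / 2)).
  rewrite (_ : - (pi / 2) + 2 * pi = 3 * pi / 2); last by field.
  have := square_primitive_half_turn dK K_period dL dM u.
  rewrite -/h => -> <-.
  by field.
have P1 (u : R) : P = (- (h u) ^+ 2 * (3 - 2 * h u) + 6 * (N (u + pi) - N u))%:E.
  rewrite (P2 u) (product_primitive dK dL dN u (u + pi)) -/(half_turn K u) -/h.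
  by congr EFin; field.
have hpi : h pi = 1 - h 0.
  by have := half_turn_opposite K_period 0; rewrite add0r.
(* Average of [P2] at [0] and at [pi]: [1 - 2 * h] changes sign after a half turn, so the cubes
   cancel, while the two half turns of [L] add up. *)
have P4 : P = (1 / 4 - 3 * (L (2 * pi) - L 0))%:E.
  have := P2 0; have := P2 pi; rewrite hpi add0r.
  rewrite (_ : pi + pi = 2 * pi); last by ring.
  rewrite PE => -[e1] [e2]; congr EFin.
  have e3 : (1 - 2 * (1 - h 0)) ^+ 3 = - (1 - 2 * h 0) ^+ 3 by ring.
  by move: e1 e2; rewrite e3; lra.
have K2pi : K (2 * pi) - K 0 = 1.
  by rewrite -[X in K X]add0r K_period addrAC subrr add0r.
have pi2 : 0 < 2 * pi :> R by rewrite mulr_gt0 ?pi_gt0.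
split; [|split; [|split; [|split]]].
- by move=> u v; rewrite HE GE (arcE _ _ _ _ _ cN dN).
- by move=> u v x; rewrite /x HE GE (arcE _ _ _ _ _ cS dL).
(* In a halving direction the cube in [P2] vanishes. *)
- have [u hu] := half_turn_bisection dK K_period.
  by exists u => v; rewrite HE (arcE _ _ _ _ _ cS dL)// (P2 u) /h hu; congr EFin; field.
(* [K] grows by [1] over the turn, so passing from [L] to [N] costs [3 / 4], and [1 / 4 - 3 / 4] is
   the constant [- (1 / 2)]. *)
- rewrite HE (arcE _ _ _ _ _ cN dN)// P4 (product_primitive dK dL dN) K2pi.
  by congr EFin; field.
- by rewrite HE (arcE _ _ _ _ _ cS dL).
Qed.
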